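(* Let $f_1,f_2\in L^2(\mathbb{R})$ be complex-valued functions such that $\mathrm{supp}(\widehat{f_1})\cap\mathrm{supp}(\widehat{f_2})=\emptyset$. Then $$\left\|e^{it\sqrt{1-\Delta}}f_1\; e^{it\sqrt{1-\Delta}}f_2\right\|_{L^2_{t,x}(\mathbb{R}^{1+1})}^2\leq \frac{1}{(2\pi)^2}\int_{\mathbb{R}^2}|\widehat{f_1}(\xi_1)|^2\,|\widehat{f_2}(\xi_2)|^2\left(1-\frac{(1,\xi_1)\cdot(1,\xi_2)}{\sqrt{1+\xi_1^2}\,\sqrt{1+\xi_2^2}}\right)^{-1}d\xi_1\,d\xi_2 .$$
   Context: The Fourier transform on $\mathbb{R}$ is normalized as $\widehat{f}(\xi)=\int_{\mathbb{R}}f(x)e^{-ix\xi}\,dx$ (extended to $L^2(\mathbb{R})$ as usual). The Klein-Gordon propagator in one space dimension is the Fourier multiplier operator $$e^{it\sqrt{1-\Delta}}f(x)=\frac{1}{2\pi}\int_{\mathbb{R}}\widehat{f}(\xi)\,e^{ix\xi+it\sqrt{1+\xi^2}}\,d\xi,\qquad (t,x)\in\mathbb{R}\times\mathbb{R}.$$ The left-hand side is the squared $L^2$ norm over $(t,x)\in\mathbb{R}\times\mathbb{R}$ of the pointwise product of the two functions $(t,x)\mapsto e^{it\sqrt{1-\Delta}}f_j(x)$, $j=1,2$. The dot denotes the Euclidean inner product on $\mathbb{R}^2$, so $(1,\xi_1)\cdot(1,\xi_2)=1+\xi_1\xi_2$. The support of $\widehat{f_j}$ is its closed (essential) support. The right-hand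 side is allowed to be $+\infty$, in which case the inequality is trivial. *)

(* Defs.v *)
From HB Require Import structures.
From mathcomp Require Import all_boot all_order all_algebra.
From mathcomp Require Import all_classical all_reals all_analysis.
From mathcomp Require Import complex.
Import Order.TTheory GRing.Theory Num.Theory numFieldNormedType.Exports.

Set Implicit Arguments.
Unset Strict Implicit.
Unset Printing Implicit Defensive.

Local Open Scope classical_set_scope.
Local Open Scope ring_scope.
Local Open Scope complex_scope.

(* Complex-valued functions are handled through their real and imaginary
   parts, since the library's integral is real-valued. *)
Definition cmeasurable_fun {d : measure_display} {T : measurableType d}
    {R : realType} (f : T -> R[i]) : Prop :=
  measurable_fun setT (fun x => complex.Re (f x)) /\
  measurable_fun setT (fun x => complex.Im (f x)).

Definition cintegral {d : measure_display} {T : measurableType d}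
    {R : realType} (mu : {measure set T -> \bar R}) (D : set T)
    (f : T -> R[i]) : R[i] :=
  (\int[mu]_(x in D) complex.Re (f x)) +i* (\int[mu]_(x in D) complex.Im (f x)).

Definition L2norm {d : measure_display} {T : measurableType d}
    {R : realType} (mu : {measure set T -> \bar R}) (f : T -> R[i]) : \bar R :=
  ('N[mu]_(2%:E) [EFin \o (fun x => ComplexField.Normc.normc (f x))])%E.

Definition inL2 {d : measure_display} {T : measurableType d}
    {R : realType} (mu : {measure set T -> \bar R}) (f : T -> R[i]) : Prop :=
  cmeasurable_fun f /\ (L2norm mu f < +oo)%E.

(* e^{i theta} *)
Definition expi {R : realType} (theta : R) : R[i] := cos theta +i* sin theta.

(* F represents the Fourier transform of f in L^2(R): F is the L^2 limit of
   the transforms of f 1_[-n, n], which lies in L^1 and L^2 whenever f is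
   in L^2. *)
Definition is_fourier {R : realType} (f F : R -> R[i]) : Prop :=
  inL2 lebesgue_measure F /\
  L2norm lebesgue_measure
    (fun xi => F xi - cintegral lebesgue_measure `[- n%:R, n%:R]
                        (fun x => f x * expi (- (x * xi))))
    @[n --> \oo] --> 0%E.

(* u represents (t, x) |-> (e^{it sqrt(1 - Delta)} f)(x) on R x R: it is jointly
   measurable and, for almost every t, u(t, .) is the inverse Fourier transform
   of e^{it sqrt(1 + xi^2)} F(xi), where F is the Fourier transform of f. As F
   is only in L^2, that integral over the line is the L^2 limit of its
   truncations. Such a u is unique up to almost everywhere equality. *)
Definition is_klein_gordon {R : realType} (f : R -> R[i]) (u : R * R -> R[i])
    : Prop :=
  cmeasurable_fun u /\
  exists2 F : R -> R[i], is_fourier f F &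
    {ae lebesgue_measure, forall t : R,
      L2norm lebesgue_measure
        (fun x => u (t, x) - ((2 * pi)^-1)%:C *
           cintegral lebesgue_measure `[- n%:R, n%:R]
             (fun xi => F xi * expi (x * xi + t * Num.sqrt (1 + xi ^+ 2))))
        @[n --> \oo] --> 0%E}.

(* Complement of the union of the open sets on which F vanishes almost
   everywhere. *)
Definition ess_support {R : realType} (F : R -> R[i]) : set R :=
  ~` \bigcup_(U in [set U : set R | open U /\
       {ae lebesgue_measure, forall x : R, U x -> F x = 0}]) U.

(* Main.v *)
From HB Require Import structures.
Require Import Defs.
From mathcomp Require Import all_boot all_order all_algebra.
From mathcomp Require Import all_classical all_reals all_analysis.
From mathcomp Require Import complex.
From mathcomp Require Import measurable_realfun.
From mathcomp Require Import ring lra.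
Import Order.TTheory GRing.Theory Num.Theory numFieldNormedType.Exports.

Set Implicit Arguments.
Unset Strict Implicit.
Unset Printing Implicit Defensive.

Local Open Scope classical_set_scope.
Local Open Scope ring_scope.
Local Open Scope complex_scope.

(** Write <xi> for sqrt (1 + xi^2) and v(xi) = xi / <xi> for its derivative, the
    group velocity. The product of the two waves is (2 pi)^-2 times the integral
    of F1(xi1) F2(xi2) exp (i (x (xi1 + xi2) + t (<xi1> + <xi2>))) over the plane
    of pairs (xi1, xi2). In the variables (xi1 + xi2, <xi1> + <xi2>) this is an
    inverse Fourier transform on R^2, and the Jacobian of that change of
    variables is |v(xi1) - v(xi2)|. The map is two-to-one, the two preimages
    being exchanged by swapping xi1 and xi2, but F1 and F2 have no common
    support, so F1(xi1) F2(xi2) is carried by one preimage only. Plancherel thus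
    gives the integral of |F1|^2 |F2|^2 / |v(xi1) - v(xi2)|, and the theorem
    follows because 1 - cos a <= |v(xi1) - v(xi2)|, where a is the angle between
    (1, xi1) and (1, xi2) ([angle_weight_le_jacobian]).

    Plancherel and the two-dimensional change of variables are both replaced by
    one Schur test ([schur_test]). Damp the space-time integral by the weight
    exp (- e (|t| + |x|)) and expand the square: what appears is the quadratic
    form of the kernel g(difference of momenta) g(difference of energies), where
    g is the Poisson kernel 2 e / (e^2 + a^2), the Fourier transform of
    exp (- e |x|). Schur's test with the Jacobian as multiplier only needs the
    integral of Jacobian times kernel. By Fubini this reduces to integrals on the
    line ([integral_jacobian_delta_kernel]), where g has the primitive
    2 atan (a / e), of total variation 2 pi for every e. Swapping the variables
    halves the bound on a product of two disjoint sets
    ([integral_jacobian_delta_kernel_disjoint]), which is how disjointness of the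
    supports enters. The bound so obtained, [weighted_bilinear_bound], does not
    depend on e and has the same constant as Plancherel's formula.

    The waves are only L^2 limits, at almost every time, of the integrals over
    [-n, n] of the data, to which the previous bound applies with e = 1 / (n + 1).
    At a fixed time, L^2 convergence of both factors gives almost everywhere
    convergence of their product along a subsequence, hence lower semicontinuity
    of the norm of the product ([normc2M_lsc]); the subsequence depends on the
    time, but the resulting inequality with a lower limit does not, and Fatou's
    lemma in time concludes ([kg_product_le]). *)

(** * Reflections and translations of the line *)

(** A measure that agrees with Lebesgue measure on intervals ]a, b] is Lebesgue
    measure, and a reflection maps such an interval to one of the same length. *)
Lemma lebesgue_measure_subr (R : realType) (s : R) (A : set R) :
  measurable A ->
  pushforward lebesgue_measure ((fun x : R => s - x) : _ -> measurableTypeR R) A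
  = lebesgue_measure A.
Proof.
move=> mA.
have mf : measurable_fun setT ((fun x : R => s - x) : R -> measurableTypeR R).
  exact: measurable_funB.
pose f : {mfun R >-> measurableTypeR R} :=
  HB.pack ((fun x : R => s - x) : R -> measurableTypeR R)
    (isMeasurableFun.Build _ _ _ _ _ mf).
apply/esym/(@lebesgue_measure_unique R (pushforward lebesgue_measure f)) => //=.
move=> _ [[a b]] _ <-.
rewrite /pushforward.
have -> : (fun x : R => s - x) @^-1` `]a, b] = `[s - b, s - a[%classic.
  by apply/seteqP; split => x /=; rewrite !in_itv/= => /andP[? ?];
    apply/andP; split; lra.
rewrite !lebesgue_measure_itv/= !lte_fin.
by congr (if _ then _ else _); [apply/idP/idP; lra|rewrite -!EFinB; congr EFin; ring].
Qed.

Lemma ge0_integral_subr (R : realType) (s : R) (f : R -> \bar R) :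
  measurable_fun setT f -> (forall x, 0 <= f x)%E ->
  (\int[lebesgue_measure]_x f (s - x)%R = \int[lebesgue_measure]_x f x)%E.
Proof.
move=> mf f0.
have mg : measurable_fun setT ((fun x : R => s - x) : R -> measurableTypeR R).
  exact: measurable_funB.
have := @ge0_integral_pushforward _ _ (measurableTypeR R) (measurableTypeR R) R _ mg
  lebesgue_measure setT f measurableT mf (fun _ _ => f0 _).
rewrite preimage_setT => <-.
by apply: eq_measure_integral => A mA _; exact: lebesgue_measure_subr.
Qed.

Lemma integral_odd (R : realType) (f : R -> R) :
  lebesgue_measure.-integrable setT (EFin \o f) -> (forall x, f (- x) = - f x) ->
  \int[lebesgue_measure]_x f x = 0.
Proof.
move=> intf oddf; have mf := measurable_int _ intf.
have e : (\int[lebesgue_measure]_x (EFin \o f)^\- x =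
          \int[lebesgue_measure]_x (EFin \o f)^\+ x)%E.
  rewrite -[RHS](@ge0_integral_subr _ 0)//; last exact: measurable_funepos.
  by apply: eq_integral => x _; rewrite sub0r funeposE funenegE /= oddf.
rewrite /Rintegral integralE e subee// ge0_fin_numE; last exact: integral_ge0.
exact: integral_funepos_lt_pinfty.
Qed.

(** * The exponential weight and its Fourier transform *)

Definition exp_weight {R : realType} (e x : R) : R := expR (- (e * `|x|)).

(** The Fourier transform of [exp_weight e]. *)
Definition poisson {R : realType} (e a : R) : R := 2 * e / (e ^+ 2 + a ^+ 2).

Lemma continuous_exp_weight (R : realType) (e : R) : continuous (exp_weight e).
Proof.
move=> x; apply: continuous_comp; last exact: continuous_expR.
apply: continuousN; apply: continuousM; first exact: cvg_cst.
exact: norm_continuous.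
Qed.

Lemma exp_weight_ge0 (R : realType) (e x : R) : 0 <= exp_weight e x.
Proof. exact: expR_ge0. Qed.

(** The factor [1 + cos] keeps the integrand nonnegative, as the fundamental theorem
    of calculus on a half-line requires; the integral of the cosine alone is
    obtained by difference in [Rintegral_exp_weight_cos]. *)
Lemma integral_exp_weight_1cos (R : realType) (e a : R) : 0 < e ->
  (\int[lebesgue_measure]_x (exp_weight e x * (1 + cos (a * x)))%:E =
   (2 / e + poisson e a)%:E)%E.
Proof.
move=> e0; have ea0 : e ^+ 2 + a ^+ 2 != 0.
  by rewrite gt_eqF// ltr_wpDr ?sqr_ge0// exprn_gt0.
have e_neq0 : e != 0 by rewrite gt_eqF.
have cc : continuous (fun x : R => cos (a * x)).
  move=> x; apply: continuous_comp; last exact: continuous_cos.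
  by apply: continuousM; [exact: cvg_cst|exact: cvg_id].
have ch : continuous (fun x : R => exp_weight e x * (1 + cos (a * x))).
  move=> x; apply: continuousM; first exact: continuous_exp_weight.
  by apply: continuousD; [exact: cvg_cst|exact: cc].
have h0 (x : R) : 0 <= exp_weight e x * (1 + cos (a * x)).
  by rewrite mulr_ge0 ?exp_weight_ge0//; have := cos_geN1 (a * x); lra.
rewrite ge0_symfun_integralT//; last first.
  by move=> x /=; rewrite /exp_weight normrN mulrN cosN.
(* a primitive of the integrand on the half-line, from the primitive of
   exp (- (e - i a) x) *)
pose F (x : R) := expR (- (e * x)) *
  (- e^-1 + (a * sin (a * x) - e * cos (a * x)) / (e ^+ 2 + a ^+ 2)).
have dF (x : R) : is_derive x 1 F (expR (- (e * x)) * (1 + cos (a * x))).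
  apply: is_derive_eq; rewrite /GRing.scale /=.
  by field; rewrite ea0 e_neq0.
have exp0 : expR (- (e * x)) @[x --> +oo] --> (0 : R).
  apply: (@cvg_comp R R R (fun x => e * x) (fun x => expR (- x)) +oo +oo
    (nbhs 0) _ (@cvgr_expR R)).
  exact: gt0_cvgMry.
rewrite -set_itvcy.
rewrite (@ge0_continuous_FTC2y _ _ F 0 0)//.
- rewrite /F mulr0 oppr0 expR0 mul1r mulr0 sin0 cos0 mulr0 sub0r mulr1.
  rewrite -EFinB -EFinM; congr EFin; rewrite /poisson.
  by field; rewrite ea0 e_neq0.
- by apply: continuous_subspaceT.
- pose M := e^-1 + (`|a| + e) / (e ^+ 2 + a ^+ 2).
  have ea : 0 < e ^+ 2 + a ^+ 2 by rewrite ltr_wpDr ?sqr_ge0// exprn_gt0.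
  apply: norm_cvg0.
  apply: (@squeeze_cvgr _ _ _ _ (cst 0) (fun x => expR (- (e * x)) * M)).
  + near=> x; rewrite normr_ge0/= /F normrM ger0_norm ?expR_ge0//.
    rewrite ler_wpM2l ?expR_ge0// (le_trans (ler_normD _ _))//.
    rewrite normrN gtr0_norm ?invr_gt0// lerD2l normrM.
    rewrite [X in _ * X]gtr0_norm ?invr_gt0// ler_pM2r ?invr_gt0//.
    rewrite (le_trans (ler_normB _ _))// !normrM (gtr0_norm e0) lerD//.
      by rewrite ler_piMr// ler_norml sin_geN1 sin_le1.
    by rewrite ler_piMr// ?(ltW e0)// ler_norml cos_geN1 cos_le1.
  + exact: cvg_cst.
  + by rewrite -(mul0r M); apply: cvgM => //; exact: cvg_cst.
- apply: cvg_at_right_filter.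
  by have [/derivable1_diffP/differentiable_continuous + _] := dF 0; exact.
- move=> x; rewrite in_itv/= andbT => x0; rewrite derive1E.
  have [_ ->] := dF x.
  by rewrite /exp_weight gtr0_norm.
Unshelve. all: end_near. Qed.

Lemma integral_exp_weight (R : realType) (e : R) : 0 < e ->
  (\int[lebesgue_measure]_x (exp_weight e x)%:E = (2 / e)%:E)%E.
Proof.
move=> e0; have := integral_exp_weight_1cos 0 e0.
have me : measurable_fun setT (exp_weight e).
  by apply: continuous_measurable_fun; exact: continuous_exp_weight.
under eq_integral do rewrite mul0r cos0 mulrC EFinM.
rewrite ge0_integralZl_EFin//; last 2 first.
- by move=> x _; rewrite lee_fin exp_weight_ge0.
- exact/measurable_EFinP.
have -> : 2 / e + poisson e 0 = (1 + 1) * (2 / e).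
  by rewrite /poisson expr0n /= addr0; field; rewrite gt_eqF.
rewrite EFinM => /(congr1 (fun x => ((1 + 1)^-1%:E * x)%E)).
by rewrite !muleA -EFinM mulVf ?gt_eqF// !mul1e.
Qed.

Lemma integrable_exp_weightM (R : realType) (e : R) (f : R -> R) : 0 < e ->
  measurable_fun setT f -> (forall x, `|f x| <= 1) ->
  lebesgue_measure.-integrable setT (fun x : R => (exp_weight e x * f x)%:E).
Proof.
move=> e0 mf f1.
have me : measurable_fun setT (exp_weight e).
  by apply: continuous_measurable_fun; exact: continuous_exp_weight.
apply: (@le_integrable _ _ _ lebesgue_measure setT measurableT _ (EFin \o exp_weight e)).
- by apply/measurable_EFinP; exact: measurable_funM.
- move=> x _ /=; rewrite lee_fin normrM ler_piMr//.
apply/integrableP; split; first exact/measurable_EFinP.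
under eq_integral do rewrite /= ger0_norm ?exp_weight_ge0//.
by rewrite integral_exp_weight// ltry.
Qed.

Lemma Rintegral_exp_weight_cos (R : realType) (e a : R) : 0 < e ->
  \int[lebesgue_measure]_x (exp_weight e x * cos (a * x)) = poisson e a.
Proof.
move=> e0.
have mc : measurable_fun setT (fun x : R => cos (a * x)).
  apply: continuous_measurable_fun => x.
  apply: continuous_comp; last exact: continuous_cos.
  by apply: continuousM; [exact: cvg_cst|exact: cvg_id].
have c1 (x : R) : `|cos (a * x)| <= 1 by rewrite ler_norml cos_geN1 cos_le1.
have i1 : lebesgue_measure.-integrable setT (fun x : R => (exp_weight e x * cst 1 x)%:E).
  by apply: integrable_exp_weightM => // x; rewrite normr1.
have i2 := integrable_exp_weightM e0 mc c1.
have := integral_exp_weight_1cos a e0.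
under eq_integral do rewrite mulrDr EFinD.
rewrite integralD//.
rewrite (_ : (\int[lebesgue_measure]_x (exp_weight e x * 1)%:E)%E = (2 / e)%:E); last first.
  by under eq_integral do rewrite mulr1; exact: integral_exp_weight.
rewrite /Rintegral -[(\int[_]_x (_ * cos _)%:E)%E]fineK; last exact: integrable_fin_num.
by rewrite -EFinD => -[] /addrI.
Qed.

Lemma Rintegral_exp_weight_sin (R : realType) (e a : R) : 0 < e ->
  \int[lebesgue_measure]_x (exp_weight e x * sin (a * x)) = 0.
Proof.
move=> e0; apply: integral_odd.
  apply: integrable_exp_weightM => //.
    apply: continuous_measurable_fun => x.
    apply: continuous_comp; last exact: continuous_sin.
    by apply: continuousM; [exact: cvg_cst|exact: cvg_id].
  by move=> x; rewrite ler_norml sin_geN1 sin_le1.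
by move=> x; rewrite /exp_weight normrN mulrN sinN mulrN.
Qed.

(** * The mass of the Poisson kernel along a curve *)

Lemma le_integral_itv (R : realType) (c : R) (f : R -> \bar R) (M : \bar R) :
  measurable_fun setT f -> (forall x, 0 <= f x)%E ->
  (forall n : nat,
    \int[lebesgue_measure]_(x in `[(c - n.+1%:R)%R, (c + n.+1%:R)%R]) f x <= M)%E ->
  (\int[lebesgue_measure]_x f x <= M)%E.
Proof.
move=> mf f0 fM.
pose I (n : nat) : set R := `[c - n.+1%:R, c + n.+1%:R]%classic.
have IT : \bigcup_n I n = setT.
  apply/seteqP; split => // x _.
  exists (Num.truncn `|x - c|) => //=; rewrite /I/= in_itv/=.
  have := truncnS_gt `|x - c|.
  by rewrite ltr_norml => /andP[? ?]; apply/andP; split; lra.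
have mI n : measurable (I n) by exact: measurable_itv.
have h := @ge0_nondecreasing_set_cvg_integral _ (measurableTypeR R) R I f lebesgue_measure.
rewrite -IT -(cvg_lim _ (h _ _ _ _)) //.
- apply: lime_le; last by apply: nearW => n; exact: fM.
  apply/cvg_ex; eexists; apply: h => //.
  + move=> m n mn; apply/subsetPset => x; rewrite /I/= !in_itv/= => /andP[? ?].
    have : (m.+1%:R <= n.+1%:R :> R) by rewrite ler_nat.
    by move=> ?; apply/andP; split; lra.
  + by move=> n; exact: measurable_funTS.
- move=> m n mn; apply/subsetPset => x; rewrite /I/= !in_itv/= => /andP[? ?].
  have : (m.+1%:R <= n.+1%:R :> R) by rewrite ler_nat.
  by move=> ?; apply/andP; split; lra.
- by move=> n; exact: measurable_funTS.
Qed.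

Lemma poisson_ge0 (R : realType) (e a : R) : 0 < e -> 0 <= poisson e a.
Proof.
by move=> e0; rewrite /poisson divr_ge0// ?mulr_ge0 ?addr_ge0 ?sqr_ge0// ltW.
Qed.

Lemma continuous_poisson (R : realType) (e : R) : 0 < e ->
  continuous (poisson e).
Proof.
move=> e0 x; rewrite /continuous_at /poisson.
apply: cvgM; first exact: cvg_cst.
apply: cvgV; first by rewrite gt_eqF// ltr_wpDr ?sqr_ge0// exprn_gt0.
by apply: cvgD; [exact: cvg_cst|exact: exprn_continuous].
Qed.

Lemma is_derive_continuous (R : realType) (f df : R -> R) :
  (forall x : R, is_derive x 1 f (df x)) -> continuous f.
Proof.
by move=> H x; have [/derivable1_diffP/differentiable_continuous + _] := H x.
Qed.

Lemma continuous_normM_poisson (R : realType) (psi dpsi : R -> R) (e : R) :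
  0 < e -> continuous psi -> continuous dpsi ->
  continuous (fun x : R => `|dpsi x| * poisson e (psi x)).
Proof.
move=> e0 cP cdP x.
apply: (@continuousM R R (fun x => `|dpsi x|) (fun x => poisson e (psi x))).
  by apply: continuous_comp; [exact: cdP|exact: norm_continuous].
by apply: continuous_comp; [exact: cP|exact: continuous_poisson].
Qed.

(** Where [psi] is monotone the integrand is, up to the sign [s], the derivative
    of 2 atan (psi / e), and atan varies by less than pi. *)
Lemma integral_poisson_itv (R : realType) (psi dpsi : R -> R) (e s a b : R) :
  0 < e -> a < b -> s = 1 \/ s = -1 ->
  (forall x : R, is_derive x 1 psi (dpsi x)) -> continuous dpsi ->
  {in `[a, b], forall x, `|dpsi x| = s * dpsi x} ->
  (\int[lebesgue_measure]_(x in `[a, b]) (`|dpsi x| * poisson e (psi x))%:E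
    <= (2 * pi)%:E)%E.
Proof.
move=> e0 ab s1 dP cdP sdP.
have cP := is_derive_continuous dP.
pose F x := s * (2 * atan (psi x / e)).
have dF (x : R) : is_derive x 1 F (s * (dpsi x * poisson e (psi x))).
  have ea : e ^+ 2 + psi x ^+ 2 != 0.
    by rewrite gt_eqF// ltr_wpDr ?sqr_ge0// exprn_gt0.
  have e_neq0 : e != 0 by rewrite gt_eqF.
  have h : is_derive x 1 (fun x => atan (psi x / e))
      ((1 + (psi x / e) ^+ 2)^-1 * (dpsi x / e)).
    apply: (@is_derive1_comp _ atan (fun x => psi x / e)).
    apply: is_derive_eq; rewrite /GRing.scale /=; ring.
  have h2 := is_deriveZ s (is_deriveZ 2 h).
  apply: (is_derive_eq h2).
  rewrite /GRing.scale /= /poisson; field.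
  by rewrite ea e_neq0.
have cF := is_derive_continuous dF.
rewrite (@continuous_FTC2 _ _ F)//.
- rewrite -EFinB lee_fin /F.
  have := atan_ltpi2 (psi a / e); have := atan_ltpi2 (psi b / e).
  have := atan_gtNpi2 (psi a / e); have := atan_gtNpi2 (psi b / e).
  by case: s1 => ->; lra.
- by apply: continuous_subspaceT; exact: continuous_normM_poisson.
- split.
  + by move=> x _; have [] := dF x.
  + by apply: cvg_at_right_filter; exact: cF.
  + by apply: cvg_at_left_filter; exact: cF.
- move=> x xab; rewrite derive1E; have [_ ->] := dF x.
  by rewrite sdP ?mulrA//; exact: subset_itv_oo_cc.
Qed.

Lemma integral_poisson (R : realType) (e : R) : 0 < e ->
  (\int[lebesgue_measure]_x (poisson e x)%:E <= (2 * pi)%:E)%E.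
Proof.
move=> e0; apply: (@le_integral_itv _ 0).
- apply/measurable_EFinP.
  by apply: continuous_measurable_fun; exact: continuous_poisson.
- by move=> x; rewrite lee_fin poisson_ge0.
move=> n; rewrite sub0r add0r.
have := @integral_poisson_itv R id (cst 1) e 1 (- n.+1%:R) n.+1%:R e0.
under eq_integral do rewrite normr1 mul1r; apply.
- by rewrite ltrNl (@lt_trans _ _ 0)// oppr_lt0.
- by left.
- by move=> x; exact: cvg_cst.
- by move=> x _; rewrite normr1 mulr1.
Qed.

(** A curve that folds once covers each value at most twice, whence twice the
    mass of the Poisson kernel. *)
Lemma integral_poisson_fold (R : realType) (psi dpsi : R -> R) (e c : R) :
  0 < e ->
  (forall x : R, is_derive x 1 psi (dpsi x)) -> continuous dpsi ->
  (forall x, x <= c -> dpsi x <= 0) -> (forall x, c <= x -> 0 <= dpsi x) ->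
  (\int[lebesgue_measure]_x (`|dpsi x| * poisson e (psi x))%:E
    <= (2 * (2 * pi))%:E)%E.
Proof.
move=> e0 dP cdP dP_le0 dP_ge0.
have cP := is_derive_continuous dP.
have mf : measurable_fun setT (fun x => (`|dpsi x| * poisson e (psi x))%:E).
  apply/measurable_EFinP; apply: continuous_measurable_fun.
  exact: continuous_normM_poisson.
have f0 x : (0 <= (`|dpsi x| * poisson e (psi x))%:E)%E.
  by rewrite lee_fin mulr_ge0 ?poisson_ge0.
apply: (@le_integral_itv _ c) => // n.
have n0 : 0 < n.+1%:R :> R by [].
rewrite (@itv_bndbnd_setU _ _ _ (BRight c)); last 2 first.
- by rewrite bnd_simp; lra.
- by rewrite bnd_simp; lra.
rewrite ge0_integral_setU//; last 2 first.
- exact: measurable_funTS.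
- by rewrite disj_set2E; apply/eqP; rewrite -subset0 => x [];
    rewrite /= !in_itv/= => /andP[_ ?] /andP[? _]; lra.
rewrite integral_itv_obnd_cbnd; last exact: measurable_funTS.
rewrite mulr_natl mulr2n EFinD; apply: leeD.
  apply: (@integral_poisson_itv _ _ _ _ (-1)) => //; [lra|by right|].
  move=> x; rewrite in_itv/= => /andP[_ xc].
  by rewrite ler0_norm ?dP_le0// mulN1r.
apply: (@integral_poisson_itv _ _ _ _ 1) => //; [lra|by left|].
move=> x; rewrite in_itv/= => /andP[xc _].
by rewrite ger0_norm ?dP_ge0// mul1r.
Qed.

(** * Dispersion relation and group velocity *)

Definition bracket {R : realType} (x : R) : R := Num.sqrt (1 + x ^+ 2).

Definition velocity {R : realType} (x : R) : R := x / bracket x.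

Lemma bracket_gt0 (R : realType) (x : R) : 0 < bracket x.
Proof. by rewrite sqrtr_gt0 ltr_wpDr ?sqr_ge0. Qed.

Lemma sqr_bracket (R : realType) (x : R) : bracket x ^+ 2 = 1 + x ^+ 2.
Proof. by rewrite sqr_sqrtr// addr_ge0 ?sqr_ge0. Qed.

Lemma is_derive_bracket (R : realType) (x : R) : is_derive x 1 bracket (velocity x).
Proof.
have x0 : 0 < 1 + x ^+ 2 by rewrite ltr_wpDr ?sqr_ge0.
have h := is_derive1_sqrt x0.
have g : is_derive x 1 (fun y : R => 1 + y ^+ 2) (2 * x).
  by apply: is_derive_eq; rewrite /GRing.scale /=; ring.
rewrite (_ : velocity x = (2 * Num.sqrt (1 + x ^+ 2))^-1 * (2 * x)).
  exact: (@is_derive1_comp _ Num.sqrt (fun y => 1 + y ^+ 2) x _ _ h g).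
by rewrite /velocity /bracket; field; rewrite gt_eqF// sqrtr_gt0.
Qed.

Lemma continuous_bracket (R : realType) : continuous (@bracket R).
Proof. exact: is_derive_continuous (@is_derive_bracket R). Qed.

Lemma continuous_velocity (R : realType) : continuous (@velocity R).
Proof.
move=> x; rewrite /continuous_at /velocity; apply: cvgM; first exact: cvg_id.
by apply: cvgV; [rewrite gt_eqF// bracket_gt0|exact: continuous_bracket].
Qed.

(** The dispersion relation is convex. *)
Lemma le_velocity (R : realType) (x y : R) : x <= y -> velocity x <= velocity y.
Proof.
move=> xy; rewrite /velocity ler_pdivrMr ?bracket_gt0// mulrAC ler_pdivlMr ?bracket_gt0//.
have jx := bracket_gt0 x; have jy := bracket_gt0 y.
have sx := sqr_bracket x; have sy := sqr_bracket y.
have [x0|x0] := leP 0 x.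
  rewrite -ler_sqr ?nnegrE ?mulr_ge0 ?(ltW jx) ?(ltW jy) ?(le_trans x0)//.
  rewrite !exprMn sx sy !mulrDr !mulr1 [y ^+ 2 * _]mulrC lerD2r.
  by rewrite ler_sqr// nnegrE (le_trans x0).
have [y0|y0] := leP 0 y.
  by rewrite (@le_trans _ _ 0) ?mulr_ge0 ?(ltW jx)// mulr_le0_ge0 ?(ltW jy) ?(ltW x0).
rewrite -lerN2 -!mulNr -ler_sqr ?nnegrE ?mulr_ge0 ?(ltW jx) ?(ltW jy)
  ?oppr_ge0 ?(ltW x0) ?(ltW y0)//.
rewrite !exprMn sx sy !mulrDr !mulr1 !sqrrN [y ^+ 2 * _]mulrC lerD2r.
rewrite -(sqrrN x) -(sqrrN y) ler_sqr ?nnegrE ?oppr_ge0 ?(ltW x0) ?(ltW y0)//.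
by rewrite lerN2.
Qed.

Lemma ge0_integral_addr (R : realType) (s : R) (f : R -> \bar R) :
  measurable_fun setT f -> (forall x, 0 <= f x)%E ->
  (\int[lebesgue_measure]_x f (x - s)%R = \int[lebesgue_measure]_x f x)%E.
Proof.
move=> mf f0.
have mg : measurable_fun setT (fun x : R => f (- x)).
  by apply: (measurableT_comp mf).
transitivity (\int[lebesgue_measure]_x (fun y => f (- y)%R) (s - x)%R)%E.
  by apply: eq_integral => x _; rewrite opprB.
rewrite (@ge0_integral_subr _ s (fun y => f (- y)%R))//.
transitivity (\int[lebesgue_measure]_x f (0 - x)%R)%E.
  by apply: eq_integral => x _; rewrite sub0r.
by rewrite (@ge0_integral_subr _ 0 f).
Qed.

(** * The kernel of the change of variables *)

(** The Jacobian of (xi1, xi2) |-> (xi1 + xi2, <xi1> + <xi2>). *)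
Definition jacobian {R : realType} (z : R * R) : R := `|velocity z.1 - velocity z.2|.

(** The Fourier transform of the weight exp (- e (|t| + |x|)), taken at the
    difference of the total momenta and of the total energies of two pairs of
    frequencies; as e tends to 0 it concentrates where both are conserved. *)
Definition delta_kernel {R : realType} (e : R) (y z : R * R) : R :=
  poisson e (y.1 + y.2 - (z.1 + z.2)) *
  poisson e (bracket y.1 + bracket y.2 - (bracket z.1 + bracket z.2)).

Lemma measurable_bracket (R : realType) : measurable_fun setT (@bracket R).
Proof. by apply: continuous_measurable_fun; exact: continuous_bracket. Qed.

Lemma measurable_velocity (R : realType) : measurable_fun setT (@velocity R).
Proof. by apply: continuous_measurable_fun; exact: continuous_velocity. Qed.

Lemma measurable_poisson (R : realType) (e : R) : 0 < e ->
  measurable_fun setT (poisson e).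
Proof.
by move=> e0; apply: continuous_measurable_fun; exact: continuous_poisson.
Qed.

Lemma measurable_jacobian (R : realType) : measurable_fun setT (@jacobian R).
Proof.
apply: measurableT_comp => //.
by apply: measurable_funB; apply: measurableT_comp => //; exact: measurable_velocity.
Qed.

Lemma measurable_delta_kernel (R : realType) (e : R) : 0 < e ->
  measurable_fun setT (fun yz : (R * R) * (R * R) => delta_kernel e yz.1 yz.2).
Proof.
move=> e0; have mj := @measurable_bracket R.
have m11 : measurable_fun setT (fun yz : (R * R) * (R * R) => yz.1.1).
  exact: measurableT_comp.
have m12 : measurable_fun setT (fun yz : (R * R) * (R * R) => yz.1.2).
  exact: measurableT_comp.
have m21 : measurable_fun setT (fun yz : (R * R) * (R * R) => yz.2.1).
  exact: measurableT_comp.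
have m22 : measurable_fun setT (fun yz : (R * R) * (R * R) => yz.2.2).
  exact: measurableT_comp.
apply: measurable_funM; apply: measurableT_comp; try exact: measurable_poisson.
  by apply: measurable_funB; apply: measurable_funD.
by apply: measurable_funB; apply: measurable_funD; exact: measurableT_comp.
Qed.

Lemma poissonC (R : realType) (e a b : R) :
  poisson e (a - b) = poisson e (b - a).
Proof. by rewrite /poisson -(sqrrN (a - b)) opprB. Qed.

Lemma delta_kernelC (R : realType) (e : R) (y z : R * R) :
  delta_kernel e y z = delta_kernel e z y.
Proof.
by rewrite /delta_kernel poissonC; congr (_ * _); rewrite poissonC.
Qed.

Lemma delta_kernel_ge0 (R : realType) (e : R) (y z : R * R) :
  0 < e -> 0 <= delta_kernel e y z.
Proof. by move=> e0; rewrite mulr_ge0 ?poisson_ge0. Qed.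

Lemma jacobian_ge0 (R : realType) (z : R * R) : 0 <= jacobian z.
Proof. exact: normr_ge0. Qed.

(** With a = z1 + z2 in place of z2, the Jacobian becomes the derivative in z1 of
    the total energy at fixed total momentum a. That energy is convex in z1 and
    symmetric about a / 2, so [integral_poisson_fold] bounds the integral in z1
    by 2 * 2 pi; the Poisson kernel in a contributes the last factor 2 pi. *)
Lemma integral_jacobian_delta_kernel (R : realType) (e : R) (y : R * R) : 0 < e ->
  (\int[lebesgue_measure \x lebesgue_measure]_z (jacobian z * delta_kernel e y z)%:E
    <= (2 * (2 * pi) ^+ 2)%:E)%E.
Proof.
move=> e0.
have m1 : measurable_fun setT (fun z : R * R => jacobian z * delta_kernel e y z).
  apply: measurable_funM; first exact: measurable_jacobian.
  exact: (measurableT_comp (measurable_delta_kernel e0) (pair1_measurable y)).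
have mk : measurable_fun setT (fun z : R * R => (jacobian z * delta_kernel e y z)%:E).
  exact/measurable_EFinP.
rewrite fubini_tonelli1//; last first.
  by move=> z; rewrite lee_fin mulr_ge0 ?jacobian_ge0 ?delta_kernel_ge0.
rewrite /fubini_F.
have pi4 : 0 <= 2 * (2 * pi) :> R by have := pi_ge0 R; lra.
pose t := bracket y.1 + bracket y.2.
(* psi a is the energy at total momentum a, relative to that of y *)
pose dpsi (a x : R) := velocity x - velocity (a - x).
pose psi (a x : R) := bracket x + bracket (a - x) - t.
pose h (z : R * R) : R :=
  poisson e (y.1 + y.2 - z.2) * (`|dpsi z.2 z.1| * poisson e (psi z.2 z.1)).
have h0 z : 0 <= h z by apply: mulr_ge0; [|apply: mulr_ge0] => //; exact: poisson_ge0.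
have mj := @measurable_bracket R; have mdj := @measurable_velocity R.
have mp := measurable_poisson e0.
have mh : measurable_fun setT h.
  have m21 : measurable_fun setT (fun z : R * R => z.2 - z.1).
    exact: measurable_funB.
  apply: measurable_funM.
    by apply: (measurableT_comp mp); apply: measurable_funB.
  apply: measurable_funM.
    apply: measurableT_comp => //.
    by apply: measurable_funB; exact: measurableT_comp.
  apply: (measurableT_comp mp); apply: measurable_funB => //.
  by apply: measurable_funD; exact: measurableT_comp.
rewrite [leLHS](_ : _ =
    \int[lebesgue_measure]_x \int[lebesgue_measure]_a (h (x, a))%:E)%E; last first.
  apply: eq_integral => x _.
  rewrite -(@ge0_integral_addr _ x
    (fun b => (jacobian (x, b) * delta_kernel e y (x, b))%:E))//; last 2 first.
  - exact: (measurableT_comp mk (pair1_measurable x)).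
  - by move=> z; rewrite lee_fin mulr_ge0 ?jacobian_ge0 ?delta_kernel_ge0.
  apply: eq_integral => a _; congr EFin.
  rewrite /jacobian /delta_kernel /h /psi /dpsi /t /= [x + (a - x)]addrC subrK.
  by rewrite (poissonC _ (bracket x + _)) mulrCA.
have emh : measurable_fun setT (EFin \o h) by exact/measurable_EFinP.
have eh0 z : (0 <= (EFin \o h) z)%E by rewrite lee_fin.
rewrite (_ : (\int[lebesgue_measure]_x _)%E =
    (\int[lebesgue_measure]_a \int[lebesgue_measure]_x (h (x, a))%:E)%E); last first.
  exact: (@fubini_tonelli _ _ (measurableTypeR R) (measurableTypeR R) R
    lebesgue_measure lebesgue_measure (EFin \o h) emh eh0).
apply: (@le_trans _ _ (\int[lebesgue_measure]_a
    ((2 * (2 * pi))%:E * (poisson e (y.1 + y.2 - a))%:E))%E).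
  apply: ge0_le_integral => //.
  - by move=> a _; apply: integral_ge0 => x _; rewrite lee_fin.
  - exact: (@measurable_fun_fubini_tonelli_G _ _ (measurableTypeR R)
      (measurableTypeR R) R lebesgue_measure (EFin \o h) emh eh0).
  - apply: measurable_funeM; apply/measurable_EFinP; apply: (measurableT_comp mp).
    exact: measurable_funB.
  move=> a _ /=.
  rewrite /h /=; under eq_integral do rewrite EFinM.
  have dP (x : R) : is_derive x 1 (psi a) (dpsi a x).
    have d1 : is_derive x 1 (fun x : R => a - x) (-1).
      by apply: is_derive_eq; rewrite /GRing.scale /=; ring.
    have d2 : is_derive x 1 (fun x : R => bracket (a - x)) (velocity (a - x) * -1).
      exact: (@is_derive1_comp _ bracket (fun x => a - x) x _ _ (is_derive_bracket _) d1).
    have d3 := is_derive_bracket x.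
    by rewrite /psi /dpsi; apply: is_derive_eq; rewrite /GRing.scale /=; ring.
  have cdP : continuous (dpsi a).
    move=> x; rewrite /continuous_at /dpsi; apply: cvgB; first exact: continuous_velocity.
    apply: (@continuous_comp _ _ _ (fun x => a - x) velocity).
      by apply: cvgB; [exact: cvg_cst|exact: cvg_id].
    exact: continuous_velocity.
  have cP := is_derive_continuous dP.
  rewrite ge0_integralZl_EFin ?poisson_ge0//; last 2 first.
  - by move=> x _; rewrite lee_fin mulr_ge0 ?poisson_ge0.
  - apply/measurable_EFinP; apply: continuous_measurable_fun.
    exact: continuous_normM_poisson.
  rewrite muleC; apply: lee_wpmul2r; first by rewrite lee_fin poisson_ge0.
  apply: (@integral_poisson_fold _ _ _ _ (a / 2)) => // x xa.
    by rewrite /dpsi subr_le0 le_velocity//; lra.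
  by rewrite /dpsi subr_ge0 le_velocity//; lra.
rewrite ge0_integralZl_EFin//; last 2 first.
- by move=> a _; rewrite lee_fin poisson_ge0.
- apply/measurable_EFinP; apply: (measurableT_comp mp).
  exact: measurable_funB.
rewrite (@ge0_integral_subr _ (y.1 + y.2) (fun a => (poisson e a)%:E)); last 2 first.
- exact/measurable_EFinP.
- by move=> a; rewrite lee_fin poisson_ge0.
rewrite (_ : 2 * (2 * pi) ^+ 2 = (2 * (2 * pi)) * (2 * pi)); last by ring.
rewrite [leRHS]EFinM; apply: lee_wpmul2l; last exact: integral_poisson.
by rewrite lee_fin.
Qed.

(** The integrand is symmetric in z1 and z2, and S1 x S2 is disjoint from its
    mirror image S2 x S1, so each carries at most half of the whole integral. *)
Lemma integral_jacobian_delta_kernel_disjoint (R : realType) (e : R) (S1 S2 : set R)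
    (y : R * R) : 0 < e -> measurable S1 -> measurable S2 ->
  S1 `&` S2 = set0 ->
  (\int[lebesgue_measure \x lebesgue_measure]_z
      (\1_S1 z.1 * \1_S2 z.2 * (jacobian z * delta_kernel e y z))%:E
    <= ((2 * pi) ^+ 2)%:E)%E.
Proof.
move=> e0 mS1 mS2 S12.
pose k z := jacobian z * delta_kernel e y z.
have k0 z : 0 <= k z by rewrite mulr_ge0 ?jacobian_ge0 ?delta_kernel_ge0.
have mk : measurable_fun setT k.
  apply: measurable_funM; first exact: measurable_jacobian.
  exact: (measurableT_comp (measurable_delta_kernel e0) (pair1_measurable y)).
have kC u v : k (u, v) = k (v, u).
  by rewrite /k /jacobian /delta_kernel /= distrC [u + v]addrC [bracket u + _]addrC.
pose g (A B : set R) (z : R * R) : R := \1_A z.1 * \1_B z.2 * k z.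
have gC (u v : R) : g S1 S2 (u, v) = g S2 S1 (v, u).
  by rewrite /g /= (kC v u); congr (_ * _); exact: mulrC.
have g0 A B z : 0 <= g A B z by apply: mulr_ge0 => //; apply: mulr_ge0.
have mg A B : measurable A -> measurable B -> measurable_fun setT (g A B).
  move=> mA mB; apply: measurable_funM => //; apply: measurable_funM.
    by apply: measurableT_comp => //; exact: measurable_indic.
  by apply: measurableT_comp => //; exact: measurable_indic.
have e1 : (\int[lebesgue_measure \x lebesgue_measure]_z (g S1 S2 z)%:E =
           \int[lebesgue_measure \x lebesgue_measure]_z (g S2 S1 z)%:E)%E.
  have emg A B : measurable A -> measurable B ->
      measurable_fun setT (EFin \o g A B).
    by move=> mA mB; apply/measurable_EFinP; exact: mg.
  have eg0 A B z : (0 <= (EFin \o g A B) z)%E by rewrite lee_fin.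
  rewrite (@fubini_tonelli1 _ _ (measurableTypeR R) (measurableTypeR R) R
    lebesgue_measure lebesgue_measure _ (emg _ _ mS1 mS2) (eg0 _ _)).
  rewrite (@fubini_tonelli2 _ _ (measurableTypeR R) (measurableTypeR R) R
    lebesgue_measure lebesgue_measure _ (emg _ _ mS2 mS1) (eg0 _ _)).
  apply: eq_integral => u _; apply: eq_integral => v _.
  exact: (congr1 EFin (gC u v)).
have half (a b : \bar R) : (2%:E * a <= 2%:E * b -> a <= b)%E.
  by rewrite lee_pmul2l // lte_fin.
refine (half _ _ _); rewrite -EFinM.
refine (le_trans _ (integral_jacobian_delta_kernel y e0)).
rewrite mule_natl mule2n {2}e1 -ge0_integralD//; last 4 first.
- by move=> z _; rewrite lee_fin; exact: (g0 S1 S2 z).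
- by apply/measurable_EFinP; exact: (mg S1 S2).
- by move=> z _; rewrite lee_fin; exact: g0.
- by apply/measurable_EFinP; exact: mg.
apply: ge0_le_integral => //.
- by move=> z _; rewrite adde_ge0// lee_fin; [exact: (g0 S1 S2 z)|exact: g0].
- apply: emeasurable_funD; apply/measurable_EFinP; last exact: mg.
  exact: (mg S1 S2).
- exact/measurable_EFinP.
move=> z _; rewrite -EFinD lee_fin /g -mulrDl -/(k z) ler_piMl//.
rewrite !indicE.
have dis w : (w \in S1) && (w \in S2) = false.
  by apply/negP => /andP[/set_mem ? /set_mem ?]; have : (S1 `&` S2) w by [];
    rewrite S12.
have := dis z.1; have := dis z.2.
case: (z.1 \in S1); case: (z.1 \in S2); case: (z.2 \in S1);
  case: (z.2 \in S2) => //=; lra.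
Qed.

(** * Products of sigma-finite measures *)

Section sigma_finite_product.
Context d1 d2 (T1 : measurableType d1) (T2 : measurableType d2) (R : realType).
Variable m1 : {sigma_finite_measure set T1 -> \bar R}.
Variable m2 : {sigma_finite_measure set T2 -> \bar R}.

(** A copy of the product measure that carries its sigma-finite structure, so that
    Fubini's theorem can be iterated. *)
Definition sigma_prod : set (T1 * T2) -> \bar R := (m1 \x m2)%E.

HB.instance Definition _ := Measure.on sigma_prod.

Let sigma_prod_sigma_finite : sigma_finite setT sigma_prod.
Proof.
have /sigma_finiteP[F [TF ndF Foo]] := sigma_finiteT m1.
have /sigma_finiteP[G [TG ndG Goo]] := sigma_finiteT m2.
exists (fun n => F n `*` G n) => [|k].
  rewrite -setXTT TF TG; apply/seteqP; split => [[x y] [/= [n _ Fx] [k _ Gy]]|].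
    exists (maxn n k) => //; split.
      by move: Fx; apply/subsetPset/ndF/leq_maxl.
    by move: Gy; apply/subsetPset/ndG/leq_maxr.
  by move=> [x y] [n _ [Fx Gy]]; split; exists n.
have [mF Fk] := Foo k; have [mG Gk] := Goo k.
split; first exact: measurableX.
by rewrite /sigma_prod product_measure1E// lte_mul_pinfty// ge0_fin_numE.
Qed.

HB.instance Definition _ :=
  Measure_isSigmaFinite.Build _ _ _ sigma_prod sigma_prod_sigma_finite.

End sigma_finite_product.

Section product_integrals.
Context d1 d2 (T1 : measurableType d1) (T2 : measurableType d2) (R : realType).
Variable m1 : {sigma_finite_measure set T1 -> \bar R}.
Variable m2 : {sigma_finite_measure set T2 -> \bar R}.

Lemma integrable_prodM (a : T1 -> R) (b : T2 -> R) :
  m1.-integrable setT (EFin \o a) -> m2.-integrable setT (EFin \o b) ->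
  (sigma_prod m1 m2).-integrable setT (fun z => (a z.1 * b z.2)%:E).
Proof.
move=> ia ib.
have ma : measurable_fun setT a by exact/measurable_EFinP/(measurable_int _ ia).
have mb : measurable_fun setT b by exact/measurable_EFinP/(measurable_int _ ib).
apply/integrable12ltyP.
  apply/measurable_EFinP; apply: measurable_funM.
    exact: (measurableT_comp ma).
  exact: (measurableT_comp mb).
have /integrableP[_ ifa] := ia; have /integrableP[_ ifb] := ib.
under eq_integral => x _.
  under eq_integral do rewrite /= normrM EFinM.
  rewrite ge0_integralZl_EFin//; last first.
    by apply/measurable_EFinP; exact: measurableT_comp.
  over.
rewrite ge0_integralZr//.
- apply: lte_mul_pinfty => //; first exact: integral_ge0.
  by rewrite ge0_fin_numE//; exact: integral_ge0.
- by apply/measurable_EFinP; exact: measurableT_comp.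
- exact: integral_ge0.
Qed.

Lemma Rintegral_prodM (a : T1 -> R) (b : T2 -> R) :
  m1.-integrable setT (EFin \o a) -> m2.-integrable setT (EFin \o b) ->
  \int[sigma_prod m1 m2]_z (a z.1 * b z.2) = (\int[m1]_x a x) * \int[m2]_y b y.
Proof.
move=> ia ib; have iab := integrable_prodM ia ib.
rewrite /Rintegral -integral12_prod_meas1//.
have -> : fubini_F m2 (fun z => (a z.1 * b z.2)%:E) =
    fun x => ((\int[m2]_y b y)%:E * (a x)%:E)%E.
  apply/funext => x; rewrite /fubini_F.
  under eq_integral do rewrite EFinM /=.
  rewrite (@integralZl _ _ _ m2 _ measurableT (EFin \o b))// muleC /Rintegral fineK//.
  exact: integrable_fin_num.
rewrite (@integralZl _ _ _ m1 _ measurableT (EFin \o a))//.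
have /fineK <- : (\int[m1]_x (a x)%:E)%E \is a fin_num by exact: integrable_fin_num.
by rewrite -EFinM /= mulrC.
Qed.

End product_integrals.

(** * Schur's test for an oscillatory integral *)

Lemma measurable_invr (R : realType) : measurable_fun setT (@GRing.inv R).
Proof.
rewrite -(setvU [set (0 : R)]); apply/measurable_funU => //.
  exact: measurableC.
split; last exact: measurable_fun_set1.
apply: open_continuous_measurable_fun.
  exact/closed_openC/accessible_closed_set1/hausdorff_accessible/Rhausdorff.
by move=> x; rewrite inE/= => /eqP x0; exact: inv_continuous.
Qed.

Section schur.
Context d1 d2 (X : measurableType d1) (Y : measurableType d2) (R : realType).
Variable m1 : {sigma_finite_measure set X -> \bar R}.
Variable m2 : {sigma_finite_measure set Y -> \bar R}.
Variables (w : X -> R) (theta : X * Y -> R) (p q : Y -> R).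
Variables (K : Y -> Y -> R) (J : Y -> R) (S : set Y) (C : R).
Hypothesis C0 : 0 <= C.
Hypothesis w0 : forall x, 0 <= w x.
Hypothesis iw : m1.-integrable setT (EFin \o w).
Hypothesis mtheta : measurable_fun setT theta.
Hypothesis ip : m2.-integrable setT (EFin \o p).
Hypothesis iq : m2.-integrable setT (EFin \o q).
Hypothesis mK : measurable_fun setT (fun yz : Y * Y => K yz.1 yz.2).
Hypothesis K0 : forall y z, 0 <= K y z.
Hypothesis KC : forall y z, K y z = K z y.
Hypothesis Kcos : forall y z,
  \int[m1]_x (w x * cos (theta (x, y) - theta (x, z))) = K y z.
Hypothesis Ksin : forall y z,
  \int[m1]_x (w x * sin (theta (x, y) - theta (x, z))) = 0.
Hypothesis mJ : measurable_fun setT J.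
Hypothesis J0 : forall y, 0 <= J y.
Hypothesis mS : measurable S.
Hypothesis pqS : forall y, ~ (S y /\ J y != 0) -> p y = 0 /\ q y = 0.
Hypothesis JKC : forall y, (\int[m2]_z (\1_S z * (J z * K y z))%:E <= C%:E)%E.

Let P (z : X * Y) := p z.2 * cos (theta z) - q z.2 * sin (theta z).
Let Q (z : X * Y) := p z.2 * sin (theta z) + q z.2 * cos (theta z).
Let u y := (p y ^+ 2 + q y ^+ 2) / J y.

Let mp : measurable_fun setT p.
Proof. exact/measurable_EFinP/(measurable_int _ ip). Qed.

Let mq : measurable_fun setT q.
Proof. exact/measurable_EFinP/(measurable_int _ iq). Qed.

Let mw : measurable_fun setT w.
Proof. exact/measurable_EFinP/(measurable_int _ iw). Qed.

Let measurable_u : measurable_fun setT u.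
Proof.
apply: measurable_funM; last exact: (measurableT_comp (@measurable_invr R) mJ).
by apply: measurable_funD; exact: measurable_funX.
Qed.

Let u0 y : 0 <= u y.
Proof. by rewrite /u divr_ge0 ?J0// addr_ge0 ?sqr_ge0. Qed.

Let mcos : measurable_fun setT (cos : R -> R).
Proof. exact: continuous_measurable_fun (@continuous_cos R). Qed.

Let msin : measurable_fun setT (sin : R -> R).
Proof. exact: continuous_measurable_fun (@continuous_sin R). Qed.

Let mP : measurable_fun setT P.
Proof.
apply: measurable_funB; apply: measurable_funM.
- exact: (measurableT_comp mp).
- exact: (measurableT_comp mcos mtheta).
- exact: (measurableT_comp mq).
- exact: (measurableT_comp msin mtheta).
Qed.

Let mQ : measurable_fun setT Q.
Proof.
apply: measurable_funD; apply: measurable_funM.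
- exact: (measurableT_comp mp).
- exact: (measurableT_comp msin mtheta).
- exact: (measurableT_comp mq).
- exact: (measurableT_comp mcos mtheta).
Qed.

Let h (y : Y) : R := `|p y| + `|q y|.

Let ih : m2.-integrable setT (EFin \o h).
Proof.
rewrite (_ : EFin \o h = (abse \o (EFin \o p)) \+ (abse \o (EFin \o q)))%E//.
by apply: integrableD => //; exact: integrable_abse.
Qed.

Let leP z : `|P z| <= h z.2.
Proof.
rewrite (le_trans (ler_normB _ _))// lerD// normrM ler_piMr// ler_norml.
  by rewrite cos_geN1 cos_le1.
by rewrite sin_geN1 sin_le1.
Qed.

Let leQ z : `|Q z| <= h z.2.
Proof.
rewrite (le_trans (ler_normD _ _))// lerD// normrM ler_piMr// ler_norml.
  by rewrite sin_geN1 sin_le1.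
by rewrite cos_geN1 cos_le1.
Qed.

Let iP x : m2.-integrable setT (fun y => (P (x, y))%:E).
Proof.
apply: (le_integrable measurableT _ _ ih).
  by apply/measurable_EFinP; exact: (measurableT_comp mP (pair1_measurable x)).
move=> y _ /=; rewrite lee_fin [leRHS]ger0_norm; first exact: (leP (x, y)).
by rewrite /h addr_ge0.
Qed.

Let iQ x : m2.-integrable setT (fun y => (Q (x, y))%:E).
Proof.
apply: (le_integrable measurableT _ _ ih).
  by apply/measurable_EFinP; exact: (measurableT_comp mQ (pair1_measurable x)).
move=> y _ /=; rewrite lee_fin [leRHS]ger0_norm; first exact: (leQ (x, y)).
by rewrite /h addr_ge0.
Qed.

Let G (xyz : X * (Y * Y)) := w xyz.1 *
  (P (xyz.1, xyz.2.1) * P (xyz.1, xyz.2.2) +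
   Q (xyz.1, xyz.2.1) * Q (xyz.1, xyz.2.2)).

Let mG : measurable_fun setT G.
Proof.
have m1' : measurable_fun setT (fun z : X * (Y * Y) => (z.1, z.2.1)).
  by apply: measurable_fun_pair => //; exact: measurableT_comp.
have m2' : measurable_fun setT (fun z : X * (Y * Y) => (z.1, z.2.2)).
  by apply: measurable_fun_pair => //; exact: measurableT_comp.
apply: measurable_funM; first exact: (measurableT_comp mw).
apply: measurable_funD; apply: measurable_funM.
- exact: (measurableT_comp mP m1').
- exact: (measurableT_comp mP m2').
- exact: (measurableT_comp mQ m1').
- exact: (measurableT_comp mQ m2').
Qed.

Let iG : (sigma_prod m1 (sigma_prod m2 m2)).-integrable setT (EFin \o G).
Proof.
have ihh := integrable_prodM ih ih.
have ib := @integrable_prodM _ _ _ _ _ m1 (sigma_prod m2 m2) w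
  (fun z => h z.1 * h z.2) iw ihh.
apply: (le_integrable measurableT _ _ (integrableD measurableT ib ib)).
  exact/measurable_EFinP.
move=> [x [y z]] _ /=; rewrite lee_fin.
have h0 t : 0 <= h t by rewrite /h addr_ge0.
rewrite [leRHS]ger0_norm ?addr_ge0 ?mulr_ge0//.
rewrite /G /= normrM (ger0_norm (w0 x)) -mulrDr ler_wpM2l//.
rewrite (le_trans (ler_normD _ _))// lerD// normrM ler_pM//;
  solve [exact: (leP (x, _)) | exact: (leQ (x, _))].
Qed.

Let A x := \int[m2]_y P (x, y).
Let B x := \int[m2]_y Q (x, y).

Let integral_G_yz x :
  (\int[sigma_prod m2 m2]_yz (G (x, yz))%:E = (w x * (A x ^+ 2 + B x ^+ 2))%:E)%E.
Proof.
have iPP := integrable_prodM (iP x) (iP x).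
have iQQ := integrable_prodM (iQ x) (iQ x).
rewrite (_ : (fun yz => (G (x, yz))%:E) = (fun yz => (w x)%:E *
    ((P (x, yz.1) * P (x, yz.2))%:E + (Q (x, yz.1) * Q (x, yz.2))%:E))%E); last first.
  by apply/funext => yz; rewrite -EFinD -EFinM.
rewrite (@integralZl _ _ _ _ _ measurableT (fun yz : Y * Y =>
  ((P (x, yz.1) * P (x, yz.2))%:E + (Q (x, yz.1) * Q (x, yz.2))%:E)%E)); last first.
  exact: integrableD.
rewrite integralD// EFinM EFinD; congr (_ * (_ + _))%E.
- rewrite -[LHS]fineK; last exact: integrable_fin_num.
  by congr EFin; rewrite expr2; exact: (Rintegral_prodM (iP x) (iP x)).
- rewrite -[LHS]fineK; last exact: integrable_fin_num.
  by congr EFin; rewrite expr2; exact: (Rintegral_prodM (iQ x) (iQ x)).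
Qed.

Let iwM (f : X -> R) : measurable_fun setT f -> (forall x, `|f x| <= 1) ->
  m1.-integrable setT (fun x => (w x * f x)%:E).
Proof.
move=> mf f1; apply: (le_integrable measurableT _ _ iw).
  by apply/measurable_EFinP; exact: measurable_funM.
by move=> x _ /=; rewrite lee_fin normrM ler_piMr.
Qed.

Let integral_G_x yz :
  (\int[m1]_x (G (x, yz))%:E =
   ((p yz.1 * p yz.2 + q yz.1 * q yz.2) * K yz.1 yz.2)%:E)%E.
Proof.
case: yz => y z /=.
have mt : measurable_fun setT (fun x => theta (x, y) - theta (x, z)).
  apply: measurable_funB.
    exact: (measurableT_comp mtheta (pair2_measurable y)).
  exact: (measurableT_comp mtheta (pair2_measurable z)).
have ic : m1.-integrable setT
    (fun x => (w x * cos (theta (x, y) - theta (x, z)))%:E).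
  apply: iwM; first exact: (measurableT_comp mcos mt).
  by move=> x; rewrite ler_norml cos_geN1 cos_le1.
have is_ : m1.-integrable setT
    (fun x => (w x * sin (theta (x, y) - theta (x, z)))%:E).
  apply: iwM; first exact: (measurableT_comp msin mt).
  by move=> x; rewrite ler_norml sin_geN1 sin_le1.
rewrite (_ : (fun x => (G (x, (y, z)))%:E) = (fun x =>
   (p y * p z + q y * q z)%:E * (w x * cos (theta (x, y) - theta (x, z)))%:E +
   (p y * q z - q y * p z)%:E * (w x * sin (theta (x, y) - theta (x, z)))%:E)%E);
    last first.
  apply/funext => x; rewrite -!EFinM -EFinD; congr EFin.
  by rewrite /G /P /Q /= cosB sinB; ring.
rewrite integralD//; last 2 first.
- exact: (integrableZl measurableT (p y * p z + q y * q z) ic).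
- exact: (integrableZl measurableT (p y * q z - q y * p z) is_).
rewrite (integralZl measurableT ic) (integralZl measurableT is_).
have := Kcos y z; have := Ksin y z; rewrite /Rintegral => sin0 cosK.
rewrite -(fineK (integrable_fin_num measurableT ic)) /= cosK.
rewrite -(fineK (integrable_fin_num measurableT is_)) /= sin0.
by rewrite mule0 adde0 EFinM.
Qed.

Let schur_pointwise y z : `|p y * p z + q y * q z| * 2 <=
  u y * (\1_S z * J z) + u z * (\1_S y * J y).
Proof.
have r0 : 0 <= u y * (\1_S z * J z) + u z * (\1_S y * J y).
  by rewrite addr_ge0// mulr_ge0// mulr_ge0.
have [[Sy Jy]|/pqS[py qy]] := pselect (S y /\ J y != 0); last first.
  by rewrite py qy !mul0r addr0 normr0 mul0r -[X in X <= _](mulr0 0) mul0r.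
have [[Sz Jz]|/pqS[pz qz]] := pselect (S z /\ J z != 0); last first.
  by rewrite pz qz !mulr0 addr0 normr0 mul0r.
rewrite !indicE !mem_set// !mul1r /u.
have Jy0 : 0 < J y by rewrite lt_def Jy J0.
have Jz0 : 0 < J z by rewrite lt_def Jz J0.
(* the arithmetic-geometric mean inequality with ratio J z / J y; the sign s
   covers both cases of the absolute value *)
have key (s : R) : s ^+ 2 = 1 -> s * (p y * p z + q y * q z) * 2 <=
    (p y ^+ 2 + q y ^+ 2) / J y * J z + (p z ^+ 2 + q z ^+ 2) / J z * J y.
  move=> s2; rewrite -subr_ge0.
  have -> : (p y ^+ 2 + q y ^+ 2) / J y * J z + (p z ^+ 2 + q z ^+ 2) / J z * J y
      - s * (p y * p z + q y * q z) * 2 =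
      ((p y * J z - s * p z * J y) ^+ 2 + (q y * J z - s * q z * J y) ^+ 2) /
      (J y * J z) + (1 - s ^+ 2) * ((p z ^+ 2 + q z ^+ 2) / J z * J y).
    by field; rewrite Jy Jz.
  rewrite s2 subrr mul0r addr0 divr_ge0 ?addr_ge0 ?sqr_ge0//.
  by rewrite mulr_ge0 ?ltW.
have k1 := key 1 (expr1n _ _).
have k2 := key (-1) (etrans (sqrrN 1) (expr1n _ _)).
by rewrite -ler_pdivlMr// ler_norml; apply/andP; split; lra.
Qed.

(** Expand the square as an integral over Y x Y and integrate in x first: this
    leaves the quadratic form of [K] applied to p + i q, to which
    [schur_pointwise] applies. Both halves of that bound have the same integral
    because [K] is symmetric, and the integral in the second variable is at most
    [C] by hypothesis. *)
Lemma schur_test :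
  (\int[m1]_x (w x * (A x ^+ 2 + B x ^+ 2))%:E <=
   C%:E * \int[m2]_y ((p y ^+ 2 + q y ^+ 2) / J y)%:E)%E.
Proof.
(* D and its mirror image E are the two halves of the bound of schur_pointwise *)
pose D (yz : Y * Y) := u yz.1 * (\1_S yz.2 * (J yz.2 * K yz.1 yz.2)).
have D0 yz : 0 <= D yz by rewrite mulr_ge0// mulr_ge0// mulr_ge0.
have mD : measurable_fun setT D.
  apply: measurable_funM; first exact: (measurableT_comp measurable_u).
  apply: measurable_funM.
    by apply: measurableT_comp => //; exact: measurable_indic.
  by apply: measurable_funM => //; exact: (measurableT_comp mJ).
pose E (yz : Y * Y) := D (yz.2, yz.1).
have mE : measurable_fun setT E.
  by apply: (measurableT_comp mD); exact: measurable_fun_pair.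
have DE : (\int[sigma_prod m2 m2]_yz (D yz)%:E =
           \int[sigma_prod m2 m2]_yz (E yz)%:E)%E.
  have emD : measurable_fun setT (EFin \o D) by exact/measurable_EFinP.
  have emE : measurable_fun setT (EFin \o E) by exact/measurable_EFinP.
  rewrite (fubini_tonelli1 (EFin \o D) emD); last by move=> z; rewrite lee_fin.
  rewrite (fubini_tonelli2 (EFin \o E) emE)//.
  by move=> z; rewrite lee_fin /E.
have ID : (\int[sigma_prod m2 m2]_yz (D yz)%:E <=
           C%:E * \int[m2]_y (u y)%:E)%E.
  have emD : measurable_fun setT (EFin \o D) by exact/measurable_EFinP.
  have eD0 z : (0 <= (EFin \o D) z)%E by rewrite lee_fin.
  rewrite (fubini_tonelli1 (EFin \o D) emD eD0).
  have eu0 (y : Y) : [set: Y] y -> (0 <= (u y)%:E)%E by rewrite lee_fin.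
  rewrite -ge0_integralZl_EFin//; last exact/measurable_EFinP.
  apply: ge0_le_integral => //.
  - by move=> y _; exact: integral_ge0.
  - exact: (measurable_fun_fubini_tonelli_F (EFin \o D)).
  - by apply: measurable_funeM; exact/measurable_EFinP.
  move=> y _; rewrite /fubini_F /D /=.
  under eq_integral do rewrite EFinM.
  rewrite ge0_integralZl_EFin//; last 2 first.
  - by move=> z _; rewrite lee_fin mulr_ge0// mulr_ge0.
  - apply/measurable_EFinP; apply: measurable_funM; first exact: measurable_indic.
    by apply: measurable_funM => //; exact: (measurableT_comp mK (pair1_measurable y)).
  by rewrite muleC lee_wpmul2r// lee_fin.
rewrite (_ : (\int[m1]_x _)%E =
    (\int[sigma_prod m2 m2]_yz \int[m1]_x (G (x, yz))%:E)%E); last first.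
  under eq_integral do rewrite -integral_G_yz.
  exact: (Fubini iG).
apply: le_trans ID.
have mN : measurable_fun setT
    (fun yz : Y * Y => `|p yz.1 * p yz.2 + q yz.1 * q yz.2| * K yz.1 yz.2).
  apply: measurable_funM => //; apply: measurableT_comp => //.
  by apply: measurable_funD; apply: measurable_funM; exact: measurableT_comp.
under eq_integral do rewrite integral_G_x.
apply: (@le_trans _ _ (\int[sigma_prod m2 m2]_yz
    (`|p yz.1 * p yz.2 + q yz.1 * q yz.2| * K yz.1 yz.2)%:E)%E).
  rewrite (le_trans (lee_abs _))// (le_trans (le_abse_integral _ _ _))//.
    apply/measurable_EFinP; apply: measurable_funM => //.
    by apply: measurable_funD; apply: measurable_funM; exact: measurableT_comp.
  by under eq_integral do rewrite /= normrM (ger0_norm (K0 _ _)).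
have half (a b : \bar R) : (2%:E * a <= 2%:E * b -> a <= b)%E.
  by rewrite lee_pmul2l // lte_fin.
refine (half _ _ _).
rewrite [leRHS]mule_natl mule2n {2}DE -ge0_integralD//; last 4 first.
- by move=> z _; rewrite lee_fin.
- exact/measurable_EFinP.
- by move=> z _; rewrite lee_fin; exact: (D0 (z.2, z.1)).
- exact/measurable_EFinP.
rewrite -ge0_integralZl_EFin//; last 2 first.
- by move=> yz _; rewrite lee_fin mulr_ge0.
- exact/measurable_EFinP.
apply: ge0_le_integral => //.
- by move=> yz _; rewrite -EFinM lee_fin !mulr_ge0.
- by apply: measurable_funeM; exact/measurable_EFinP.
- by apply: emeasurable_funD; exact/measurable_EFinP.
move=> [y z] _ /=; rewrite -EFinM -EFinD lee_fin /E /D /= (KC z y).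
have := schur_pointwise y z; have := K0 y z.
move=> Kyz /(ler_wpM2r Kyz); congr (_ <= _); ring.
Qed.

End schur.

(** * The bilinear bound for integrable data *)

Lemma velocity_inj (R : realType) : injective (@velocity R).
Proof.
move=> x y; rewrite /velocity => xy.
have jx := bracket_gt0 x; have jy := bracket_gt0 y.
have jx0 : bracket x != 0 by rewrite gt_eqF.
have jy0 : bracket y != 0 by rewrite gt_eqF.
have e1 : x * bracket y = y * bracket x.
  rewrite (_ : x * bracket y = x / bracket x * (bracket x * bracket y)); last by field.
  by rewrite xy; field.
have e2 : x ^+ 2 = y ^+ 2.
  have := congr1 (fun z => z ^+ 2) e1; rewrite !exprMn !sqr_bracket => ?; lra.
have e3 : bracket x = bracket y by rewrite /bracket e2.
by move: e1; rewrite e3 => /(mulIf jy0).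
Qed.

Section waves.
Context (R : realType).
Notation mu := (@lebesgue_measure R).
Variables (a b : R -> R).
Hypothesis ia : mu.-integrable setT (EFin \o a).
Hypothesis ib : mu.-integrable setT (EFin \o b).

(** The real and imaginary parts of (a + i b)(xi) exp (i (x xi + t <xi>)). *)
Definition wave_re (t x xi : R) : R :=
  a xi * cos (x * xi + t * bracket xi) - b xi * sin (x * xi + t * bracket xi).

Definition wave_im (t x xi : R) : R :=
  a xi * sin (x * xi + t * bracket xi) + b xi * cos (x * xi + t * bracket xi).

Let mphase (t x : R) : measurable_fun setT (fun xi : R => x * xi + t * bracket xi).
Proof.
apply: measurable_funD; apply: measurable_funM => //; exact: measurable_bracket.
Qed.

Let integrableM_bounded (f g : R -> R) : mu.-integrable setT (EFin \o f) ->
  measurable_fun setT g -> (forall x, `|g x| <= 1) ->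
  mu.-integrable setT (fun x => (f x * g x)%:E).
Proof.
move=> if_ mg g1; apply: (le_integrable measurableT _ _ if_).
  apply/measurable_EFinP; apply: measurable_funM => //.
  by apply/measurable_EFinP; exact: measurable_int if_.
by move=> x _ /=; rewrite lee_fin normrM ler_piMr.
Qed.

Let mcos (t x : R) : measurable_fun setT (fun xi => cos (x * xi + t * bracket xi)).
Proof.
exact: (measurableT_comp (continuous_measurable_fun (@continuous_cos R)) (mphase t x)).
Qed.

Let msin (t x : R) : measurable_fun setT (fun xi => sin (x * xi + t * bracket xi)).
Proof.
exact: (measurableT_comp (continuous_measurable_fun (@continuous_sin R)) (mphase t x)).
Qed.

Let cos1 (y : R) : `|cos y| <= 1.
Proof. by rewrite ler_norml cos_geN1 cos_le1. Qed.

Let sin1 (y : R) : `|sin y| <= 1.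
Proof. by rewrite ler_norml sin_geN1 sin_le1. Qed.

Lemma integrable_wave_re t x :
  mu.-integrable setT (fun xi => (wave_re t x xi)%:E).
Proof.
exact: (integrableB measurableT
  (integrableM_bounded ia (mcos t x) (fun=> cos1 _))
  (integrableM_bounded ib (msin t x) (fun=> sin1 _))).
Qed.

Lemma integrable_wave_im t x :
  mu.-integrable setT (fun xi => (wave_im t x xi)%:E).
Proof.
exact: (integrableD measurableT
  (integrableM_bounded ia (msin t x) (fun=> sin1 _))
  (integrableM_bounded ib (mcos t x) (fun=> cos1 _))).
Qed.

End waves.

Section weighted_bound.
Context (R : realType).
Notation mu := (@lebesgue_measure R).
Variables (e : R) (a1 b1 a2 b2 : R -> R).
Hypothesis e0 : 0 < e.
Hypothesis ia1 : mu.-integrable setT (EFin \o a1).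
Hypothesis ib1 : mu.-integrable setT (EFin \o b1).
Hypothesis ia2 : mu.-integrable setT (EFin \o a2).
Hypothesis ib2 : mu.-integrable setT (EFin \o b2).
Hypothesis dis : forall x, a1 x ^+ 2 + b1 x ^+ 2 = 0 \/ a2 x ^+ 2 + b2 x ^+ 2 = 0.

Let A1 (t x : R) := \int[mu]_xi wave_re a1 b1 t x xi.
Let B1 (t x : R) := \int[mu]_xi wave_im a1 b1 t x xi.
Let A2 (t x : R) := \int[mu]_xi wave_re a2 b2 t x xi.
Let B2 (t x : R) := \int[mu]_xi wave_im a2 b2 t x xi.

Let w (tx : R * R) : R := exp_weight e tx.1 * exp_weight e tx.2.
Let theta (z : (R * R) * (R * R)) : R :=
  z.1.2 * (z.2.1 + z.2.2) + z.1.1 * (bracket z.2.1 + bracket z.2.2).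
Let p (z : R * R) : R := a1 z.1 * a2 z.2 - b1 z.1 * b2 z.2.
Let q (z : R * R) : R := a1 z.1 * b2 z.2 + b1 z.1 * a2 z.2.
Let S1 : set R := [set x | a1 x ^+ 2 + b1 x ^+ 2 != 0].
Let S2 : set R := [set x | a2 x ^+ 2 + b2 x ^+ 2 != 0].

Let iexpw : mu.-integrable setT (EFin \o exp_weight e).
Proof.
have := @integrable_exp_weightM R e (cst 1) e0.
under eq_fun do rewrite mulr1; apply=> // x; rewrite normr1//.
Qed.

Let iexpw_cos c : mu.-integrable setT (fun x : R => (exp_weight e x * cos (c * x))%:E).
Proof.
apply: integrable_exp_weightM => //.
  apply: continuous_measurable_fun => x.
  apply: continuous_comp; last exact: continuous_cos.
  by apply: continuousM; [exact: cvg_cst|exact: cvg_id].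
by move=> x; rewrite ler_norml cos_geN1 cos_le1.
Qed.

Let iexpw_sin c : mu.-integrable setT (fun x : R => (exp_weight e x * sin (c * x))%:E).
Proof.
apply: integrable_exp_weightM => //.
  apply: continuous_measurable_fun => x.
  apply: continuous_comp; last exact: continuous_sin.
  by apply: continuousM; [exact: cvg_cst|exact: cvg_id].
by move=> x; rewrite ler_norml sin_geN1 sin_le1.
Qed.

Let integral_w_cos (c d : R) :
  \int[sigma_prod mu mu]_tx (w tx * cos (tx.2 * d + tx.1 * c)) =
  poisson e c * poisson e d.
Proof.
rewrite (_ : (fun tx : R * R => w tx * cos (tx.2 * d + tx.1 * c)) = (fun tx =>
  (exp_weight e tx.1 * cos (c * tx.1)) * (exp_weight e tx.2 * cos (d * tx.2)) -
  (exp_weight e tx.1 * sin (c * tx.1)) * (exp_weight e tx.2 * sin (d * tx.2)))); last first.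
  by apply/funext => tx; rewrite cosD /w (mulrC tx.1) (mulrC tx.2); ring.
rewrite RintegralB//; last 2 first.
- exact: (integrable_prodM (iexpw_cos c) (iexpw_cos d)).
- exact: (integrable_prodM (iexpw_sin c) (iexpw_sin d)).
rewrite (Rintegral_prodM (iexpw_cos c) (iexpw_cos d)).
rewrite (Rintegral_prodM (iexpw_sin c) (iexpw_sin d)).
by rewrite !Rintegral_exp_weight_cos// !Rintegral_exp_weight_sin// mul0r subr0.
Qed.

Let integral_w_sin (c d : R) :
  \int[sigma_prod mu mu]_tx (w tx * sin (tx.2 * d + tx.1 * c)) = 0.
Proof.
rewrite (_ : (fun tx : R * R => w tx * sin (tx.2 * d + tx.1 * c)) = (fun tx =>
  (exp_weight e tx.1 * cos (c * tx.1)) * (exp_weight e tx.2 * sin (d * tx.2)) +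
  (exp_weight e tx.1 * sin (c * tx.1)) * (exp_weight e tx.2 * cos (d * tx.2)))); last first.
  by apply/funext => tx; rewrite sinD /w (mulrC tx.1) (mulrC tx.2); ring.
rewrite RintegralD//; last 2 first.
- exact: (integrable_prodM (iexpw_cos c) (iexpw_sin d)).
- exact: (integrable_prodM (iexpw_sin c) (iexpw_cos d)).
rewrite (Rintegral_prodM (iexpw_cos c) (iexpw_sin d)).
rewrite (Rintegral_prodM (iexpw_sin c) (iexpw_cos d)).
by rewrite !Rintegral_exp_weight_sin// mul0r mulr0 addr0.
Qed.

Let mS (a b : R -> R) : measurable_fun setT a -> measurable_fun setT b ->
  measurable [set x | a x ^+ 2 + b x ^+ 2 != 0].
Proof.
move=> ma mb; rewrite (_ : [set x | _] =
    (fun x => a x ^+ 2 + b x ^+ 2) @^-1` (~` [set 0])); last first.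
  by apply/seteqP; split => x /= /eqP.
rewrite -[X in measurable X]setTI.
have m : measurable_fun setT (fun x => a x ^+ 2 + b x ^+ 2).
  by apply: measurable_funD; exact: measurable_funX.
by apply: m => //; exact: measurableC.
Qed.

(** [schur_test] with the pair (t, x) as outer variable and a pair of frequencies
    as inner variable: the weight is a product of exponentials, so its cosine
    transform is [delta_kernel] and its sine transform vanishes by parity, while
    the product of the two waves is a single oscillatory integral over the plane
    by Fubini. *)
Lemma weighted_bilinear_bound :
  (\int[mu \x mu]_tx (exp_weight e tx.1 * exp_weight e tx.2 *
     ((A1 tx.1 tx.2 ^+ 2 + B1 tx.1 tx.2 ^+ 2) *
      (A2 tx.1 tx.2 ^+ 2 + B2 tx.1 tx.2 ^+ 2)))%:E <=
   ((2 * pi) ^+ 2)%:E * \int[mu \x mu]_z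
     ((a1 z.1 ^+ 2 + b1 z.1 ^+ 2) * (a2 z.2 ^+ 2 + b2 z.2 ^+ 2) / jacobian z)%:E)%E.
Proof.
have ma1 : measurable_fun setT a1 by apply/measurable_EFinP; exact: measurable_int ia1.
have mb1 : measurable_fun setT b1 by apply/measurable_EFinP; exact: measurable_int ib1.
have ma2 : measurable_fun setT a2 by apply/measurable_EFinP; exact: measurable_int ia2.
have mb2 : measurable_fun setT b2 by apply/measurable_EFinP; exact: measurable_int ib2.
have S12 : S1 `&` S2 = set0.
  by apply/seteqP; split => // x [s1 s2]; case: (dis x) => h;
    [move: s1|move: s2]; rewrite /S1 /S2 /= h eqxx.
have mS1 : measurable S1 by exact: mS.
have mS2 : measurable S2 by exact: mS.
have mSS : measurable (S1 `*` S2) by exact: measurableX.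
have ip : (sigma_prod mu mu).-integrable setT (EFin \o p).
  have := integrableB measurableT (integrable_prodM ia1 ia2) (integrable_prodM ib1 ib2).
  exact.
have iq : (sigma_prod mu mu).-integrable setT (EFin \o q).
  have := integrableD measurableT (integrable_prodM ia1 ib2) (integrable_prodM ib1 ia2).
  exact.
have iw : (sigma_prod mu mu).-integrable setT (EFin \o w).
  exact: (integrable_prodM iexpw iexpw).
have w0 tx : 0 <= w tx by rewrite mulr_ge0 ?exp_weight_ge0.
have mtheta : measurable_fun setT theta.
  have mj := @measurable_bracket R.
  have m11 : measurable_fun setT (fun yz : (R * R) * (R * R) => yz.1.1).
    exact: measurableT_comp.
  have m12 : measurable_fun setT (fun yz : (R * R) * (R * R) => yz.1.2).
    exact: measurableT_comp.
  have m21 : measurable_fun setT (fun yz : (R * R) * (R * R) => yz.2.1).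
    exact: measurableT_comp.
  have m22 : measurable_fun setT (fun yz : (R * R) * (R * R) => yz.2.2).
    exact: measurableT_comp.
  apply: measurable_funD; apply: measurable_funM => //; apply: measurable_funD => //;
    exact: measurableT_comp.
have Kcos y z : \int[sigma_prod mu mu]_tx
    (w tx * cos (theta (tx, y) - theta (tx, z))) = delta_kernel e y z.
  rewrite /delta_kernel mulrC -integral_w_cos; apply: eq_Rintegral => tx _.
  by congr (_ * cos _); rewrite /theta /=; ring.
have Ksin y z : \int[sigma_prod mu mu]_tx
    (w tx * sin (theta (tx, y) - theta (tx, z))) = 0.
  rewrite -(integral_w_sin (bracket y.1 + bracket y.2 - (bracket z.1 + bracket z.2))
    (y.1 + y.2 - (z.1 + z.2))); apply: eq_Rintegral => tx _.
  by congr (_ * sin _); rewrite /theta /=; ring.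
(* a resonant pair in S1 x S2 would have equal velocities, hence equal
   frequencies, in S1 and S2 at once *)
have pqS y : ~ ((S1 `*` S2) y /\ jacobian y != 0) -> p y = 0 /\ q y = 0.
  have z2 (a b : R) : a ^+ 2 + b ^+ 2 = 0 -> a = 0 /\ b = 0.
    move/eqP; rewrite paddr_eq0 ?sqr_ge0// !sqrf_eq0 => /andP[/eqP-> /eqP->] //.
  rewrite /p /q; case: y => x y /=.
  have [/z2[-> ->]|/eqP Sx] := eqVneq (a1 x ^+ 2 + b1 x ^+ 2) 0.
    by rewrite !mul0r subr0 addr0.
  have [/z2[-> ->]|/eqP Sy] := eqVneq (a2 y ^+ 2 + b2 y ^+ 2) 0.
    by rewrite !mulr0 subr0 addr0.
  case; split; first by split; apply/eqP.
  rewrite /jacobian/= normr_eq0 subr_eq0; apply/eqP => /velocity_inj xy.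
  by move: Sy; rewrite -xy; case: (dis x).
have JKC y : (\int[sigma_prod mu mu]_z
    (\1_(S1 `*` S2) z * (jacobian z * delta_kernel e y z))%:E <= ((2 * pi) ^+ 2)%:E)%E.
  apply: le_trans (integral_jacobian_delta_kernel_disjoint y e0 mS1 mS2 S12).
  rewrite le_eqVlt; apply/orP; left; apply/eqP; apply: eq_integral => z _.
  congr (EFin (_ * _)); rewrite !indicE -natrM mulnb; congr (_%:R).
  case: z => x' y'; congr nat_of_bool; apply/idP/andP => /=.
    by move=> /set_mem[/= h1 h2]; rewrite !mem_set.
  by move=> [/set_mem h1 /set_mem h2]; rewrite mem_set.
have pi2 : 0 <= (2 * pi) ^+ 2 :> R by exact: sqr_ge0.
have mjac := @measurable_jacobian R.
have hA tx : \int[sigma_prod mu mu]_y (p y * cos (theta (tx, y)) -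
    q y * sin (theta (tx, y))) =
    A1 tx.1 tx.2 * A2 tx.1 tx.2 - B1 tx.1 tx.2 * B2 tx.1 tx.2.
  case: tx => t x /=.
  have r1 := integrable_wave_re ia1 ib1 t x; have r2 := integrable_wave_re ia2 ib2 t x.
  have i1 := integrable_wave_im ia1 ib1 t x; have i2 := integrable_wave_im ia2 ib2 t x.
  rewrite -(Rintegral_prodM r1 r2) -(Rintegral_prodM i1 i2) -RintegralB//; last 2 first.
  - exact: (integrable_prodM r1 r2).
  - exact: (integrable_prodM i1 i2).
  apply: eq_Rintegral => y _; rewrite /theta /p /q /wave_re /wave_im /=.
  rewrite (_ : x * (y.1 + y.2) + t * (bracket y.1 + bracket y.2) =
    (x * y.1 + t * bracket y.1) + (x * y.2 + t * bracket y.2)); last by ring.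
  rewrite (cosD (x * y.1 + t * bracket y.1)) (sinD (x * y.1 + t * bracket y.1)).
  by ring.
have hB tx : \int[sigma_prod mu mu]_y (p y * sin (theta (tx, y)) +
    q y * cos (theta (tx, y))) =
    A1 tx.1 tx.2 * B2 tx.1 tx.2 + B1 tx.1 tx.2 * A2 tx.1 tx.2.
  case: tx => t x /=.
  have r1 := integrable_wave_re ia1 ib1 t x; have r2 := integrable_wave_re ia2 ib2 t x.
  have i1 := integrable_wave_im ia1 ib1 t x; have i2 := integrable_wave_im ia2 ib2 t x.
  rewrite -(Rintegral_prodM r1 i2) -(Rintegral_prodM i1 r2) -RintegralD//; last 2 first.
  - exact: (integrable_prodM r1 i2).
  - exact: (integrable_prodM i1 r2).
  apply: eq_Rintegral => y _; rewrite /theta /p /q /wave_re /wave_im /=.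
  rewrite (_ : x * (y.1 + y.2) + t * (bracket y.1 + bracket y.2) =
    (x * y.1 + t * bracket y.1) + (x * y.2 + t * bracket y.2)); last by ring.
  rewrite (cosD (x * y.1 + t * bracket y.1)) (sinD (x * y.1 + t * bracket y.1)).
  by ring.
have := @schur_test _ _ _ _ _ (sigma_prod mu mu) (sigma_prod mu mu) w theta p q
  (delta_kernel e) jacobian
  (S1 `*` S2) ((2 * pi) ^+ 2) pi2 w0 iw mtheta ip iq (measurable_delta_kernel e0)
  (fun y z => delta_kernel_ge0 y z e0) (delta_kernelC e) Kcos Ksin mjac
  (@jacobian_ge0 R) mSS pqS JKC.
congr (_ <= _)%E; last congr (_ * _)%E.
- apply: eq_integral => tx _; congr EFin; rewrite hA hB /w; congr (_ * _); ring.
- apply: eq_integral => z _; congr EFin; rewrite /p /q; congr (_ / _); ring.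
Qed.

End weighted_bound.

(** * Comparison of the Jacobian with the angle *)

(** Cauchy-Schwarz for the vectors (1, x) and (1, y). *)
Lemma angle_weight_ge0 (R : realType) (x y : R) :
  0 <= 1 - (1 + x * y) / (bracket x * bracket y).
Proof.
rewrite subr_ge0 ler_pdivrMr ?mulr_gt0 ?bracket_gt0// mul1r.
rewrite (le_trans (ler_norm _))// -[leRHS]ger0_norm ?mulr_ge0 ?(ltW (bracket_gt0 _))//.
rewrite -ler_sqr ?nnegrE ?normr_ge0// !real_normK ?num_real//.
rewrite exprMn !sqr_bracket -subr_ge0.
rewrite (_ : _ - _ = (x - y) ^+ 2) ?sqr_ge0//; ring.
Qed.

(** With x = sinh p and y = sinh q this reads cosh (p - q) - 1 <= |sinh (p - q)|
    after multiplication by cosh p cosh q, which holds as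
    sinh^2 - (cosh - 1)^2 = 2 (cosh - 1) >= 0. *)
Lemma angle_weight_le_jacobian (R : realType) (x y : R) :
  1 - (1 + x * y) / (bracket x * bracket y) <= jacobian (x, y).
Proof.
have jx := bracket_gt0 x; have jy := bracket_gt0 y.
have jx0 : bracket x != 0 by rewrite gt_eqF.
have jy0 : bracket y != 0 by rewrite gt_eqF.
have := angle_weight_ge0 x y.
rewrite (_ : 1 - _ / _ =
    (bracket x * bracket y - x * y - 1) / (bracket x * bracket y)); last first.
  by field; rewrite jx0 jy0.
rewrite /jacobian /velocity /=.
rewrite (_ : x / bracket x - y / bracket y =
    (x * bracket y - y * bracket x) / (bracket x * bracket y)); last first.
  by field; rewrite jx0 jy0.
have jxy : 0 < (bracket x * bracket y)^-1 by rewrite invr_gt0 mulr_gt0.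
rewrite normrM (gtr0_norm jxy) ler_pM2r// pmulr_lge0// => d0.
rewrite -ler_sqr ?nnegrE ?normr_ge0// real_normK ?num_real// -subr_ge0.
rewrite (_ : _ - _ = 2 * (bracket x * bracket y - x * y - 1) +
  (1 - (bracket x ^+ 2 - x ^+ 2) * (bracket y ^+ 2 - y ^+ 2))); last by ring.
by rewrite !sqr_bracket !addrK mulr1 subrr addr0 mulr_ge0.
Qed.

(** * Squared moduli and L2 norms *)

Definition normc2 {R : rcfType} (z : R[i]) : R := complex.Re z ^+ 2 + complex.Im z ^+ 2.

Lemma normc2_ge0 (R : rcfType) (z : R[i]) : 0 <= normc2 z.
Proof. by rewrite addr_ge0 ?sqr_ge0. Qed.

Lemma sqr_normc (R : rcfType) (z : R[i]) : ComplexField.Normc.normc z ^+ 2 = normc2 z.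
Proof. by case: z => a b; rewrite /normc2 /= sqr_sqrtr// addr_ge0 ?sqr_ge0. Qed.

Lemma normc2M (R : rcfType) (z1 z2 : R[i]) : normc2 (z1 * z2) = normc2 z1 * normc2 z2.
Proof. by case: z1 z2 => a b [c d]; rewrite /normc2 /=; ring. Qed.

Lemma normc2_sub_le (R : rcfType) (a b c : R[i]) :
  normc2 (a - b) <= 2 * (normc2 (a - c) + normc2 (b - c)).
Proof.
case: a b c => [a1 a2] [b1 b2] [c1 c2]; rewrite /normc2 /=.
rewrite -subr_ge0.
rewrite (_ : _ - _ = (a1 + b1 - 2 * c1) ^+ 2 + (a2 + b2 - 2 * c2) ^+ 2).
  by rewrite addr_ge0 ?sqr_ge0.
by ring.
Qed.

(** On the diagonal the left-hand side is 0 by the convention on division by 0,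
    while the right-hand side is 0 or +oo. *)
Lemma div_jacobian_le (R : realType) (z : R * R) (r : R) : 0 <= r ->
  ((r / jacobian z)%:E <= r%:E * ((1 - (1 + z.1 * z.2) /
           (Num.sqrt (1 + z.1 ^+ 2) * Num.sqrt (1 + z.2 ^+ 2)))%R%:E)^-1)%E.
Proof.
move=> r0; have := angle_weight_ge0 z.1 z.2; have := angle_weight_le_jacobian z.1 z.2.
rewrite -/(bracket z.1) -/(bracket z.2) -surjective_pairing.
set k := (1 - _ / _)%R => kj k0.
rewrite inver; case: eqP => [k_eq0|/eqP k_neq0].
  have [->|r_neq0] := eqVneq r 0; first by rewrite mul0r mul0e.
  by rewrite gt0_muley ?leey// lte_fin lt_def r_neq0.
have k_gt0 : 0 < k by rewrite lt_def k_neq0.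
by rewrite -EFinM lee_fin ler_wpM2l// lef_pV2 ?posrE// (lt_le_trans k_gt0).
Qed.

Lemma L2norm_sqr d (T : measurableType d) (R : realType)
    (mu : {measure set T -> \bar R}) (f : T -> R[i]) :
  (L2norm mu f ^+ 2 = \int[mu]_x (normc2 (f x))%:E)%E.
Proof.
have sqE (x : \bar R) : (0 <= x -> x ^+ 2 = x `^ 2)%E.
  case: x => // [r|]; last by rewrite poweRyr// expe2.
  by rewrite lee_fin => r0; rewrite poweR_EFin powR_mulrn.
rewrite sqE ?Lnorm_ge0// /L2norm poweR_Lnorm//.
apply: eq_integral => x _ /=.
by rewrite powR_mulrn// real_normK ?num_real// sqr_normc.
Qed.

Lemma L2_cvg0 d (T : measurableType d) (R : realType)
    (mu : {measure set T -> \bar R}) (f : nat -> T -> R[i]) (e : R) :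
  L2norm mu (f n) @[n --> \oo] --> 0%E -> 0 < e ->
  \forall n \near \oo, (\int[mu]_x (normc2 (f n x))%:E <= e%:E)%E.
Proof.
move=> f0 e0.
have se0 : 0 < Num.sqrt e by rewrite sqrtr_gt0.
have : \forall n \near \oo, (L2norm mu (f n) < (Num.sqrt e)%:E)%E.
  apply: (f0 [set x | (x < (Num.sqrt e)%:E)%E]); apply: open_nbhs_nbhs.
  by split; [exact: open_ereal_lt_ereal|rewrite /= lte_fin].
apply: filterS => n /ltW nle; rewrite -L2norm_sqr.
rewrite -[e]sqr_sqrtr ?(ltW e0)// EFin_expe.
by rewrite !expe2 lee_pmul// Lnorm_ge0.
Qed.

(** * Truncated oscillatory integrals *)

Lemma aeS d (T : measurableType d) (R : realType)
    (mu : {measure set T -> \bar R}) (P Q : T -> Prop) :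
  (forall x, P x -> Q x) ->
  {ae mu, forall x, P x} -> {ae mu, forall x, Q x}.
Proof. by move=> PQ; apply: filterS. Qed.

Lemma aeI d (T : measurableType d) (R : realType)
    (mu : {measure set T -> \bar R}) (P Q : T -> Prop) :
  {ae mu, forall x, P x} -> {ae mu, forall x, Q x} ->
  {ae mu, forall x, P x /\ Q x}.
Proof. by move=> aeP aeQ; apply: filterS2 aeP aeQ. Qed.

(** Tonelli for the positive and negative parts; the difference is measurable even
    where both integrals are infinite. *)
Lemma measurable_param_integral d1 d2 (T1 : measurableType d1)
    (T2 : measurableType d2) (R : realType)
    (m : {sigma_finite_measure set T2 -> \bar R}) (f : T1 * T2 -> \bar R) :
  measurable_fun setT f -> measurable_fun setT (fun x => \int[m]_y f (x, y))%E.
Proof.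
move=> mf.
rewrite (_ : (fun x => \int[m]_y f (x, y)) =
  ((fun x => \int[m]_y f^\+ (x, y)) \- (fun x => \int[m]_y f^\- (x, y))))%E.
  apply: emeasurable_funB.
    by apply: (measurable_fun_fubini_tonelli_F f^\+%E) => //; exact: measurable_funepos.
  by apply: (measurable_fun_fubini_tonelli_F f^\-%E) => //; exact: measurable_funeneg.
apply/funext => x; rewrite [LHS]integralE.
by under eq_integral do rewrite funepos_comp/=;
   under [X in (_ - X = _)%E]eq_integral do rewrite funeneg_comp/=.
Qed.

Lemma measurable_param_Rintegral d1 d2 (T1 : measurableType d1)
    (T2 : measurableType d2) (R : realType)
    (m : {sigma_finite_measure set T2 -> \bar R}) (f : T1 * T2 -> R) :
  measurable_fun setT f -> measurable_fun setT (fun x => \int[m]_y f (x, y)).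
Proof.
move=> mf; apply: measurableT_comp; first exact: fine_measurable.
by apply: (@measurable_param_integral _ _ _ _ _ m (EFin \o f)); exact/measurable_EFinP.
Qed.

(** Restricting the data instead of the domain turns an integral over [-n, n] into
    one over the line that stays linear in the data. *)
Definition trunc {R : realType} (n : nat) (a : R -> R) (x : R) : R :=
  a x * \1_(`[- n%:R, n%:R]%classic : set R) x.

Lemma measurable_trunc {R : realType} n (a : R -> R) :
  measurable_fun setT a -> measurable_fun setT (trunc n a).
Proof.
by move=> ma; apply: measurable_funM => //; exact: measurable_indic.
Qed.

Lemma Rintegral_trunc {R : realType} n (f : R -> R) :
  \int[lebesgue_measure]_(x in `[- n%:R, n%:R]) f x =
  \int[lebesgue_measure]_x trunc n f x.
Proof.
rewrite Rintegral_mkcond; apply: eq_Rintegral => x _.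
by rewrite patchE /trunc indicE; case: ifPn => _; rewrite ?mulr1 ?mulr0.
Qed.

Lemma cintegral_expi {R : realType} n (F : R -> R[i]) (theta : R -> R) :
  cintegral lebesgue_measure `[- n%:R, n%:R] (fun x => F x * expi (theta x)) =
  (\int[lebesgue_measure]_x
     (trunc n (fun x => complex.Re (F x)) x * cos (theta x) -
      trunc n (fun x => complex.Im (F x)) x * sin (theta x))) +i*
  (\int[lebesgue_measure]_x
     (trunc n (fun x => complex.Re (F x)) x * sin (theta x) +
      trunc n (fun x => complex.Im (F x)) x * cos (theta x))).
Proof.
rewrite /cintegral !Rintegral_trunc; congr (_ +i* _); apply: eq_Rintegral => x _;
  rewrite /trunc /expi; case: (F x) => a b /=; ring.
Qed.

Lemma ae_trunc_integral {R : realType} (n : nat) (a b a' b' c s : R -> R) :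
  measurable_fun setT a -> measurable_fun setT b ->
  measurable_fun setT a' -> measurable_fun setT b' ->
  measurable_fun setT c -> measurable_fun setT s ->
  {ae lebesgue_measure, forall x : R, a x = a' x /\ b x = b' x} ->
  \int[lebesgue_measure]_x (trunc n a x * c x + trunc n b x * s x) =
  \int[lebesgue_measure]_x (trunc n a' x * c x + trunc n b' x * s x).
Proof.
move=> ma mb ma' mb' mc ms ab; rewrite /Rintegral; congr fine.
have m f g : measurable_fun setT f -> measurable_fun setT g ->
    measurable_fun setT (fun x => (trunc n f x * c x + trunc n g x * s x)%:E).
  move=> mf mg; apply/measurable_EFinP.
  by apply: measurable_funD; apply: measurable_funM => //; exact: measurable_trunc.
apply: ae_eq_integral => //; [exact: m|exact: m|].
by apply: aeS ab => x [eqa eqb] _; rewrite /trunc eqa eqb.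
Qed.

(** A square-integrable function is integrable on bounded intervals, since
    |a| <= a^2 + 1. *)
Lemma integrable_trunc {R : realType} n (F : R -> R[i]) (a : R -> R) :
  measurable_fun setT a -> (forall x, a x ^+ 2 <= normc2 (F x)) ->
  (L2norm lebesgue_measure F < +oo)%E ->
  cmeasurable_fun F ->
  lebesgue_measure.-integrable setT (EFin \o trunc n a).
Proof.
move=> ma aF F2 [mRe mIm].
have msq : measurable_fun setT (fun x => normc2 (F x)).
  by apply: measurable_funD; exact: measurable_funX.
have i1 : lebesgue_measure.-integrable setT (fun x : R => (normc2 (F x))%:E).
  apply/integrableP; split; first exact/measurable_EFinP.
  under eq_integral do rewrite /= ger0_norm ?normc2_ge0//.
  by rewrite -L2norm_sqr expe2 lte_mul_pinfty// ?Lnorm_ge0// ge0_fin_numE ?Lnorm_ge0.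
have i2 := @integrable_indic_itv R (- n%:R) n%:R true false.
apply: (le_integrable measurableT _ _ (integrableD measurableT i1 i2)).
  by apply/measurable_EFinP; exact: measurable_trunc.
move=> x _ /=; rewrite lee_fin /trunc.
rewrite [leRHS]ger0_norm; last by apply: addr_ge0 => //; exact: normc2_ge0.
rewrite normrM [X in _ * X]ger0_norm// indicE; case: (_ \in _).
  rewrite mulr1; have := aF x.
  rewrite -[a x ^+ 2]real_normK ?num_real//; have := normr_ge0 (a x).
  set r := `|a x| => r0 rF; have := sqr_ge0 (r - 1).
  rewrite sqrrB (_ : true%:R = 1 :> R)//; lra.
by rewrite mulr0 addr0 normc2_ge0.
Qed.

(** * Lower semicontinuity of the norm of a product *)

Lemma measurable_normc2 d (T : measurableType d) (R : realType) (f : T -> R[i]) :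
  cmeasurable_fun f -> measurable_fun setT (fun x => normc2 (f x)).
Proof. by move=> [mr mi]; apply: measurable_funD; exact: measurable_funX. Qed.

Lemma measurable_normc2B d (T : measurableType d) (R : realType) (f g : T -> R[i]) :
  cmeasurable_fun f -> cmeasurable_fun g ->
  measurable_fun setT (fun x => normc2 (f x - g x)).
Proof.
move=> [mfr mfi] [mgr mgi].
rewrite (_ : (fun x => _) = (fun x => (complex.Re (f x) - complex.Re (g x)) ^+ 2 +
  (complex.Im (f x) - complex.Im (g x)) ^+ 2)).
  by apply: measurable_funD; apply: measurable_funX; exact: measurable_funB.
by apply/funext => x; case: (f x) (g x) => ? ? [? ?].
Qed.

(** The sum over k has a finite integral, so it is finite almost everywhere, and
    the terms of a convergent series tend to 0. *)
Lemma ae_cvg0_of_summable d (T : measurableType d) (R : realType)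
    (mu : {measure set T -> \bar R}) (f : nat -> T -> R) :
  (forall k, measurable_fun setT (f k)) -> (forall k x, 0 <= f k x) ->
  (forall k, \int[mu]_x (f k x)%:E <= (1 / (2 ^ k.+1)%:R)%:E)%E ->
  {ae mu, forall x, f k x @[k --> \oo] --> 0}.
Proof.
move=> mf f0 fk.
pose g x := (\sum_(k <oo) (f k x)%:E)%E.
have g0 x : (0 <= g x)%E by apply: nneseries_ge0 => k _ _; rewrite lee_fin.
have mg : measurable_fun setT g.
  apply: ge0_emeasurable_sum => [k x _ _|k _]; first by rewrite lee_fin.
  exact/measurable_EFinP.
have ig : mu.-integrable setT g.
  apply/integrableP; split=> //.
  under eq_integral do rewrite gee0_abs//.
  rewrite integral_nneseries//; last 2 first.
  - by move=> k; exact/measurable_EFinP.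
  - by move=> k x _; rewrite lee_fin.
  apply: (@le_lt_trans _ _ 1%:E); last by rewrite ltry.
  rewrite (le_trans _ (@epsilon_trick0 _ 1 xpredT _))//.
  apply: lee_nneseries => k *; last exact: fk.
  by apply: integral_ge0 => x _; rewrite lee_fin.
apply: aeS (integrable_ae measurableT ig) => x /(_ I) gfin.
apply: cvg_series_cvg_0; apply: nondecreasing_is_cvgn.
  move=> m n mn; rewrite /series/= -(subnKC mn) /index_iota !subn0 iotaD big_cat/=.
  by rewrite lerDl sumr_ge0.
exists (fine (g x)) => _ [n _ <-]; rewrite -lee_fin fineK//.
rewrite /series /= -sumEFin.
by apply: (nneseries_lim_ge (u_ := fun k => (f k x)%:E)) => k _ _; rewrite lee_fin.
Qed.

Lemma cvg_sqr0 (R : realType) (s : nat -> R) (a : nat -> R) (l : R) :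
  s n @[n --> \oo] --> 0 -> (forall n, (l - a n) ^+ 2 <= s n) ->
  a n @[n --> \oo] --> l.
Proof.
move=> s0 sa; apply/cvgrPdist_le => e e0.
have e2 : 0 < e ^+ 2 by rewrite exprn_gt0.
move/cvgrPdist_le : s0 => /(_ _ e2); apply: filterS => n.
rewrite sub0r normrN => sn.
rewrite -ler_sqr ?nnegrE ?(ltW e0)// real_normK ?num_real//.
by rewrite (le_trans (sa n))// (le_trans (ler_norm _)).
Qed.

Lemma cvg_normc2 (R : realType) (v_ : nat -> R[i]) (v : R[i]) :
  normc2 (v - v_ n) @[n --> \oo] --> 0 -> normc2 (v_ n) @[n --> \oo] --> normc2 v.
Proof.
move=> v0; rewrite /normc2.
have hr : complex.Re (v_ n) @[n --> \oo] --> complex.Re v.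
  apply: (cvg_sqr0 v0) => n; case: v (v_ n) {v0} => a b [c d].
  by rewrite /normc2/= lerDl sqr_ge0.
have hi : complex.Im (v_ n) @[n --> \oo] --> complex.Im v.
  apply: (cvg_sqr0 v0) => n; case: v (v_ n) {v0 hr} => a b [c d].
  by rewrite /normc2/= lerDr sqr_ge0.
by apply: cvgD; apply: cvgM.
Qed.

Lemma limn_einf_le (R : realType) (u : nat -> \bar R) (M : \bar R) :
  (forall n, u n <= M)%E -> (limn_einf u <= M)%E.
Proof.
move=> uM; rewrite limn_einf_lim; apply: lime_le; first exact: is_cvg_einfs.
apply: nearW => n; apply: le_trans (uM n); apply: ereal_inf_lbound.
by exists n => /=.
Qed.

Lemma limn_einf_ge0 (R : realType) (u : nat -> \bar R) :
  (forall n, 0 <= u n)%E -> (0 <= limn_einf u)%E.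
Proof.
move=> u0; rewrite limn_einf_lim; apply: lime_ge; first exact: is_cvg_einfs.
by apply: nearW => n; apply: le_ereal_inf_tmp => _ [m _ <-].
Qed.

Lemma measurable_limn_einf d (T : measurableType d) (R : realType)
    (f : nat -> T -> \bar R) : (forall n, measurable_fun setT (f n)) ->
  measurable_fun setT (fun x => limn_einf (f^~ x)).
Proof.
move=> mf; rewrite (_ : (fun x => _) =
    (fun x => - limn_esup (fun n => - f n x))%E); last first.
  apply/funext => x; have := limn_esupN (f^~ x).
  by rewrite /comp => ->; rewrite oppeK.
apply: measurableT_comp => //.
by apply: measurable_fun_limn_esup => n; exact: measurableT_comp.
Qed.

(** A lower limit is approached from above, so that it is tested on the values
    [M] that the sequence frequently does not exceed. *)
Lemma le_limn_einf (R : realType) (u : nat -> \bar R) (I : \bar R) :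
  (forall n, 0 <= u n)%E ->
  (forall M, (forall k, exists2 n, (k <= n)%N & u n <= M) -> I <= M)%E ->
  (I <= limn_einf u)%E.
Proof.
move=> u0 IM.
have L0 := limn_einf_ge0 u0.
have [->|Loo] := eqVneq (limn_einf u) +oo%E; first by rewrite leey.
apply/lee_addgt0Pr => e e0; apply: IM => k.
have : (einfs u k < limn_einf u + e%:E)%E.
  apply: (@le_lt_trans _ _ (limn_einf u)).
    rewrite limn_einf_lim (cvg_lim _ (@cvg_einfs_sup _ u))//.
    by apply: ereal_sup_ubound; exists k.
  by rewrite lteDl ?lte_fin// ge0_fin_numE// ltey.
by move=> /ereal_inf_lt[_ [n /= kn <-]] /ltW; exists n.
Qed.

(** If the norms along the sequence are frequently at most [M], choose indices
    where this happens and where both factors are within 2^-k of their limit: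
    along them the product converges almost everywhere and Fatou's lemma bounds
    the norm of the limit by [M]. *)
Lemma normc2M_lsc d (T : measurableType d) (R : realType)
    (mu : {measure set T -> \bar R}) (v w : T -> R[i]) (v_ w_ : nat -> T -> R[i])
    (c : nat -> T -> R) :
  cmeasurable_fun v -> cmeasurable_fun w ->
  (forall n, cmeasurable_fun (v_ n)) -> (forall n, cmeasurable_fun (w_ n)) ->
  (forall n, measurable_fun setT (c n)) -> (forall n x, 0 <= c n x) ->
  (forall x, c n x @[n --> \oo] --> (1 : R)) ->
  (forall e, 0 < e -> \forall n \near \oo,
    (\int[mu]_x (normc2 (v x - v_ n x))%:E <= e%:E)%E) ->
  (forall e, 0 < e -> \forall n \near \oo,
    (\int[mu]_x (normc2 (w x - w_ n x))%:E <= e%:E)%E) ->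
  (\int[mu]_x (normc2 (v x) * normc2 (w x))%:E <=
   limn_einf (fun n => \int[mu]_x (c n x * (normc2 (v_ n x) * normc2 (w_ n x)))%:E))%E.
Proof.
move=> mv mw mv_ mw_ mc c0 c1 hv hw.
have mA n : measurable_fun setT (fun x => c n x * (normc2 (v_ n x) * normc2 (w_ n x))).
  by do 2 apply: measurable_funM => //; exact: measurable_normc2.
have A0 n x : 0 <= c n x * (normc2 (v_ n x) * normc2 (w_ n x)).
  by rewrite mulr_ge0// mulr_ge0// normc2_ge0.
apply: le_limn_einf => [n|M freq].
  by apply: integral_ge0 => x _; rewrite lee_fin.
have eps_gt0 k : 0 < 1 / (2 ^ k.+1)%:R :> R by rewrite divr_gt0// ltr0n expn_gt0.
(* the mass 2^-(k+1) makes the squared distances summable *)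
have /choice[n_ n_P] : forall k, exists n, [/\ (k <= n)%N,
    (\int[mu]_x (normc2 (v x - v_ n x))%:E <= (1 / (2 ^ k.+1)%:R)%:E)%E,
    (\int[mu]_x (normc2 (w x - w_ n x))%:E <= (1 / (2 ^ k.+1)%:R)%:E)%E &
    (\int[mu]_x (c n x * (normc2 (v_ n x) * normc2 (w_ n x)))%:E <= M)%E].
  move=> k; have [N1 _ hN1] := hv _ (eps_gt0 k); have [N2 _ hN2] := hw _ (eps_gt0 k).
  have [n] := freq (maxn k (maxn N1 N2)); rewrite !geq_max => /and3P[kn N1n N2n] nM.
  by exists n; split => //; [exact: hN1|exact: hN2].
have n_oo : n_ k @[k --> \oo] --> \oo.
  apply/cvgnyPge => A; exists A => // k /= Ak.
  by have [kn _ _ _] := n_P k; rewrite (leq_trans Ak).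
have aev : {ae mu, forall x, normc2 (v x - v_ (n_ k) x) @[k --> \oo] --> 0}.
  apply: ae_cvg0_of_summable => [k|k x|k]; [exact: measurable_normc2B|exact: normc2_ge0|].
  by have [] := n_P k.
have aew : {ae mu, forall x, normc2 (w x - w_ (n_ k) x) @[k --> \oo] --> 0}.
  apply: ae_cvg0_of_summable => [k|k x|k]; [exact: measurable_normc2B|exact: normc2_ge0|].
  by have [] := n_P k.
pose f k x := (c (n_ k) x * (normc2 (v_ (n_ k) x) * normc2 (w_ (n_ k) x)))%:E.
have mf k : measurable_fun setT (f k) by exact/measurable_EFinP.
apply: (@le_trans _ _ (\int[mu]_x limn_einf (f^~ x))%E).
  apply: ae_ge0_le_integral => //.
  - by move=> x _; rewrite lee_fin mulr_ge0 ?normc2_ge0.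
  - by apply/measurable_EFinP; apply: measurable_funM; exact: measurable_normc2.
  - by move=> x _; apply: limn_einf_ge0 => k; rewrite lee_fin.
  - exact: measurable_limn_einf.
  apply: aeS (aeI aev aew) => x [vx wx] _.
  have fx : f k x @[k --> \oo] --> (normc2 (v x) * normc2 (w x))%:E.
    apply: cvg_EFin; first exact: nearW.
    rewrite -[X in _ --> X]mul1r; apply: cvgM.
      exact: (cvg_comp n_ (c^~ x) n_oo (c1 x)).
    by apply: cvgM; exact: cvg_normc2.
  by rewrite (cvg_limn_einf_sup fx).1.
apply: le_trans (fatou mu measurableT mf _) _.
  by move=> k x _; rewrite lee_fin.
apply: limn_einf_le => k; by have [] := n_P k.
Qed.

(** * Supports and uniqueness of the Fourier transform *)

(** A point outside one of the supports has a neighbourhood with rational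
    endpoints on which the corresponding function vanishes almost everywhere, and
    there are countably many such intervals. *)
Lemma ess_support_disjoint (R : realType) (F1 F2 : R -> R[i]) :
  ess_support F1 `&` ess_support F2 = set0 ->
  {ae lebesgue_measure, forall x : R, F1 x = 0 \/ F2 x = 0}.
Proof.
move=> F12.
pose I (q : rat * rat) : set R := `]ratr q.1, ratr q.2[%classic.
pose nul (F : R -> R[i]) (q : rat * rat) : Prop :=
  {ae lebesgue_measure, forall x : R, I q x -> F x = 0}.
pose N (q : rat * rat) : set R :=
  [set x | (nul F1 q \/ nul F2 q) /\ I q x /\ ~ (F1 x = 0 \/ F2 x = 0)].
have negN q : lebesgue_measure.-negligible (N q).
  have [[n1|n2]|nn] := pselect (nul F1 q \/ nul F2 q).
  - apply: negligibleS n1 => x [_ [Ix Fx]] /= h; apply: Fx; left; exact: h.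
  - apply: negligibleS n2 => x [_ [Ix Fx]] /= h; apply: Fx; right; exact: h.
  - by apply: negligibleS (negligible_set0 _) => x [].
have cover x : exists2 q, I q x & nul F1 q \/ nul F2 q.
  have : ~ (ess_support F1 `&` ess_support F2) x by rewrite F12.
  have key (F : R -> R[i]) : ~ ess_support F x -> exists2 q, I q x & nul F q.
    move=> /contrapT [U [oU FU] Ux].
    have [e e0 eU] : exists2 e : R, 0 < e & ball x e `<=` U.
      by have /nbhs_ballP[e /= e0 eU] := open_nbhs_nbhs (conj oU Ux); exists e.
    have [q qx] := @rat_in_itvoo R (x - e) x ltac:(lra).
    have [r rx] := @rat_in_itvoo R x (x + e) ltac:(lra).
    move: qx rx; rewrite !in_itv /= => /andP[q1 q2] /andP[r1 r2].
    exists (q, r); first by rewrite /I /= in_itv /= q2 r1.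
    apply: aeS FU => y yU; rewrite /I /= in_itv /= => /andP[y1 y2].
    apply: yU; apply: eU; rewrite /ball /= ltr_norml; apply/andP; split; lra.
  move=> /not_andP [/key[q Iq Fq]|/key[q Iq Fq]]; exists q => //; [left|right] => //.
pose M (n : nat) := N (odflt (0, 0) (unpickle n)).
have negM : lebesgue_measure.-negligible (\bigcup_n M n).
  by apply: negligible_bigcup => n; exact: negN.
apply: negligibleS negM => x /= Fx.
have [q Iq nq] := cover x.
by exists (pickle q) => //; rewrite /M pickleK /=.
Qed.

Lemma normc2_eq0 (R : rcfType) (z : R[i]) : normc2 z = 0 -> z = 0.
Proof.
case: z => a b /eqP; rewrite /normc2 /= paddr_eq0 ?sqr_ge0// !sqrf_eq0.
by move=> /andP[/eqP -> /eqP ->].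
Qed.

(** The squared modulus of the difference of two limits is at most twice the sum of
    the squared distances to a common approximation. *)
Lemma L2_limit_unique d (T : measurableType d) (R : realType)
    (mu : {measure set T -> \bar R}) (F G : T -> R[i]) (H : nat -> T -> R[i]) :
  cmeasurable_fun F -> cmeasurable_fun G -> (forall n, cmeasurable_fun (H n)) ->
  L2norm mu (fun x => F x - H n x) @[n --> \oo] --> 0%E ->
  L2norm mu (fun x => G x - H n x) @[n --> \oo] --> 0%E ->
  {ae mu, forall x, F x = G x}.
Proof.
move=> mF mG mH FH GH.
have mB := measurable_normc2B mF mG.
have mFH n := measurable_normc2B mF (mH n).
have mGH n := measurable_normc2B mG (mH n).
suff int0 : (\int[mu]_x `|(normc2 (F x - G x))%:E| = 0)%E.
  have /(ae_eq_integral_abs mu measurableT) := int0.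
  move=> /(_ _)/wrap[]; first exact/measurable_EFinP.
  by apply: aeS => x /(_ I) [] /normc2_eq0/eqP; rewrite subr_eq0 => /eqP.
apply/eqP; rewrite eq_le integral_ge0// andbT.
apply/lee_addgt0Pr => e e0; rewrite add0e.
have e4 : 0 < e / 4 by rewrite divr_gt0.
have [N1 _ hN1] := L2_cvg0 FH e4; have [N2 _ hN2] := L2_cvg0 GH e4.
pose n := maxn N1 N2.
have h1 := hN1 n (leq_maxl _ _); have h2 := hN2 n (leq_maxr _ _).
apply: (@le_trans _ _ (\int[mu]_x
    (2%:E * ((normc2 (F x - H n x))%:E + (normc2 (G x - H n x))%:E)))%E).
  apply: ge0_le_integral => //.
  - by apply: measurableT_comp => //; exact/measurable_EFinP.
  - by apply: measurable_funeM; apply: emeasurable_funD; exact/measurable_EFinP.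
  move=> x _; rewrite gee0_abs ?lee_fin ?normc2_ge0//.
  exact: normc2_sub_le.
rewrite ge0_integralZl_EFin//; last 2 first.
- by move=> x _; rewrite lee_fin addr_ge0 ?normc2_ge0.
- by apply: emeasurable_funD; exact/measurable_EFinP.
rewrite ge0_integralD//; last 4 first.
- by move=> x _; rewrite lee_fin normc2_ge0.
- exact/measurable_EFinP.
- by move=> x _; rewrite lee_fin normc2_ge0.
- exact/measurable_EFinP.
apply: (@le_trans _ _ (2%:E * ((e / 4)%:E + (e / 4)%:E))%E).
  by apply: lee_wpmul2l => //; exact: leeD.
by rewrite -EFinD -EFinM lee_fin; lra.
Qed.

(** Both transforms are L2 limits of the same truncated integrals. *)
Lemma is_fourier_unique (R : realType) (f F G : R -> R[i]) :
  cmeasurable_fun f -> is_fourier f F -> is_fourier f G ->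
  {ae lebesgue_measure, forall x : R, F x = G x}.
Proof.
move=> [mfr mfi] [[mF _] hF] [[mG _] hG].
apply: (L2_limit_unique mF mG _ hF hG) => n.
have mphase : measurable_fun setT (fun z : R * R => - (z.2 * z.1)).
  by apply: measurable_funN; exact: measurable_funM.
have mc : measurable_fun setT (fun z : R * R => cos (- (z.2 * z.1))).
  exact: (measurableT_comp (continuous_measurable_fun (@continuous_cos R)) mphase).
have ms : measurable_fun setT (fun z : R * R => sin (- (z.2 * z.1))).
  exact: (measurableT_comp (continuous_measurable_fun (@continuous_sin R)) mphase).
have mtr (a : R -> R) : measurable_fun setT a ->
    measurable_fun setT (fun z : R * R => trunc n a z.2).
  by move=> ma; exact: (measurableT_comp (measurable_trunc n ma)).
split; rewrite /=.
  rewrite (_ : (fun xi => _) = (fun xi => \int[lebesgue_measure]_x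
      (trunc n (fun x => complex.Re (f x)) x * cos (- (x * xi)) -
       trunc n (fun x => complex.Im (f x)) x * sin (- (x * xi))))); last first.
    apply/funext => xi.
    exact: (congr1 (@complex.Re R) (cintegral_expi n f (fun x => - (x * xi)))).
  apply: (@measurable_param_Rintegral _ _ _ _ _ lebesgue_measure (fun z : R * R =>
    trunc n (fun x => complex.Re (f x)) z.2 * cos (- (z.2 * z.1)) -
    trunc n (fun x => complex.Im (f x)) z.2 * sin (- (z.2 * z.1)))).
  by apply: measurable_funB; apply: measurable_funM => //; exact: mtr.
rewrite (_ : (fun xi => _) = (fun xi => \int[lebesgue_measure]_x
    (trunc n (fun x => complex.Re (f x)) x * sin (- (x * xi)) +
     trunc n (fun x => complex.Im (f x)) x * cos (- (x * xi))))); last first.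
  apply/funext => xi.
  exact: (congr1 (@complex.Im R) (cintegral_expi n f (fun x => - (x * xi)))).
apply: (@measurable_param_Rintegral _ _ _ _ _ lebesgue_measure (fun z : R * R =>
  trunc n (fun x => complex.Re (f x)) z.2 * sin (- (z.2 * z.1)) +
  trunc n (fun x => complex.Im (f x)) z.2 * cos (- (z.2 * z.1)))).
by apply: measurable_funD; apply: measurable_funM => //; exact: mtr.
Qed.

(** * Truncated Klein-Gordon waves *)

(** The n-th approximation in the definition of the propagator, as a function of
    time and space jointly. *)
Definition kg_trunc {R : realType} (n : nat) (F : R -> R[i]) (tx : R * R) : R[i] :=
  ((2 * pi)^-1)%:C * cintegral lebesgue_measure `[- n%:R, n%:R]
    (fun xi => F xi * expi (tx.2 * xi + tx.1 * bracket xi)).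

Lemma kg_truncE (R : realType) n (F : R -> R[i]) (tx : R * R) :
  let a := trunc n (fun x => complex.Re (F x)) in
  let b := trunc n (fun x => complex.Im (F x)) in
  kg_trunc n F tx = ((2 * pi)^-1)%:C *
    ((\int[lebesgue_measure]_xi wave_re a b tx.1 tx.2 xi) +i*
     (\int[lebesgue_measure]_xi wave_im a b tx.1 tx.2 xi)).
Proof.
move=> a b; rewrite /kg_trunc; congr (_ * _).
exact: (cintegral_expi n F (fun xi => tx.2 * xi + tx.1 * bracket xi)).
Qed.

Lemma ReZ (R : rcfType) (r : R) (z : R[i]) : complex.Re (r%:C * z) = r * complex.Re z.
Proof. by case: z => a b /=; rewrite mul0r subr0. Qed.

Lemma ImZ (R : rcfType) (r : R) (z : R[i]) : complex.Im (r%:C * z) = r * complex.Im z.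
Proof. by case: z => a b /=; rewrite mul0r addr0. Qed.

Lemma measurable_phase (R : realType) :
  measurable_fun setT (fun z : (R * R) * R => z.1.2 * z.2 + z.1.1 * bracket z.2).
Proof.
have m11 : measurable_fun setT (fun yz : (R * R) * R => yz.1.1).
  exact: measurableT_comp.
have m12 : measurable_fun setT (fun yz : (R * R) * R => yz.1.2).
  exact: measurableT_comp.
apply: measurable_funD; apply: measurable_funM => //.
by apply: measurableT_comp => //; exact: measurable_bracket.
Qed.

Lemma cmeasurable_kg_trunc (R : realType) n (F : R -> R[i]) :
  cmeasurable_fun F -> cmeasurable_fun (kg_trunc n F).
Proof.
move=> [mr mi].
have mc : measurable_fun setT
    (fun z : (R * R) * R => cos (z.1.2 * z.2 + z.1.1 * bracket z.2)).
  exact: (measurableT_comp (continuous_measurable_fun (@continuous_cos R))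
    (@measurable_phase R)).
have ms : measurable_fun setT
    (fun z : (R * R) * R => sin (z.1.2 * z.2 + z.1.1 * bracket z.2)).
  exact: (measurableT_comp (continuous_measurable_fun (@continuous_sin R))
    (@measurable_phase R)).
have mtr (a : R -> R) : measurable_fun setT a ->
    measurable_fun setT (fun z : (R * R) * R => trunc n a z.2).
  by move=> ma; exact: (measurableT_comp (measurable_trunc n ma)).
pose a := trunc n (fun x => complex.Re (F x)).
pose b := trunc n (fun x => complex.Im (F x)).
have mre : measurable_fun setT
    (fun tx : R * R => \int[lebesgue_measure]_xi wave_re a b tx.1 tx.2 xi).
  apply: (@measurable_param_Rintegral _ _ _ _ _ lebesgue_measure
    (fun z : (R * R) * R => wave_re a b z.1.1 z.1.2 z.2)).
  by apply: measurable_funB; apply: measurable_funM => //; exact: mtr.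
have mim : measurable_fun setT
    (fun tx : R * R => \int[lebesgue_measure]_xi wave_im a b tx.1 tx.2 xi).
  apply: (@measurable_param_Rintegral _ _ _ _ _ lebesgue_measure
    (fun z : (R * R) * R => wave_im a b z.1.1 z.1.2 z.2)).
  by apply: measurable_funD; apply: measurable_funM => //; exact: mtr.
split.
- rewrite (_ : (fun tx => _) = (fun tx : R * R => (2 * pi)^-1 *
    \int[lebesgue_measure]_xi wave_re a b tx.1 tx.2 xi)); last first.
    by apply/funext => tx; rewrite kg_truncE ReZ.
  exact: measurable_funM.
- rewrite (_ : (fun tx => _) = (fun tx : R * R => (2 * pi)^-1 *
    \int[lebesgue_measure]_xi wave_im a b tx.1 tx.2 xi)); last first.
    by apply/funext => tx; rewrite kg_truncE ImZ.
  exact: measurable_funM.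
Qed.

Lemma ae_kg_trunc (R : realType) n (F G : R -> R[i]) :
  cmeasurable_fun F -> cmeasurable_fun G ->
  {ae lebesgue_measure, forall x : R, F x = G x} -> kg_trunc n F = kg_trunc n G.
Proof.
move=> [mFr mFi] [mGr mGi] FG; apply/funext => -[t x].
have mp : measurable_fun setT (fun xi : R => x * xi + t * bracket xi).
  exact: (measurableT_comp (@measurable_phase R) (pair1_measurable (t, x))).
have mc := measurableT_comp (continuous_measurable_fun (@continuous_cos R)) mp.
have ms := measurableT_comp (continuous_measurable_fun (@continuous_sin R)) mp.
have FG2 : {ae lebesgue_measure, forall x : R,
    complex.Re (F x) = complex.Re (G x) /\ complex.Im (F x) = complex.Im (G x)}.
  by apply: aeS FG => y ->.
rewrite !kg_truncE; congr (_ * (_ +i* _)).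
- rewrite /wave_re.
  have h := ae_trunc_integral n mFr mFi mGr mGi mc (measurable_funN ms) FG2.
  transitivity (\int[lebesgue_measure]_xi
    (trunc n (fun x => complex.Re (F x)) xi * cos (x * xi + t * bracket xi) +
     trunc n (fun x => complex.Im (F x)) xi * - sin (x * xi + t * bracket xi))).
    by apply: eq_Rintegral => xi _; rewrite mulrN.
  rewrite [LHS]h; apply: eq_Rintegral => xi _; by rewrite /= mulrN.
- exact: (ae_trunc_integral n mFr mFi mGr mGi ms mc FG2).
Qed.

Lemma normc2_kg_trunc (R : realType) n (F : R -> R[i]) (tx : R * R) :
  let a := trunc n (fun x => complex.Re (F x)) in
  let b := trunc n (fun x => complex.Im (F x)) in
  normc2 (kg_trunc n F tx) = (2 * pi) ^- 2 *
    ((\int[lebesgue_measure]_xi wave_re a b tx.1 tx.2 xi) ^+ 2 +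
     (\int[lebesgue_measure]_xi wave_im a b tx.1 tx.2 xi) ^+ 2).
Proof.
move=> a b; rewrite kg_truncE /normc2 ReZ ImZ /= -exprVn -/a -/b.
by set c := (2 * pi)^-1; ring.
Qed.

Lemma sqr_trunc (R : realType) n (F : R -> R[i]) x :
  trunc n (fun x => complex.Re (F x)) x ^+ 2 +
  trunc n (fun x => complex.Im (F x)) x ^+ 2 =
  normc2 (F x) * \1_(`[- n%:R, n%:R]%classic : set R) x.
Proof.
rewrite /trunc /normc2 !exprMn indicE; case: (_ \in _) => /=.
  by rewrite !expr1n !mulr1.
by rewrite expr0n /= !mulr0 addr0.
Qed.

(** The integral of a nonnegative function is a supremum over simple functions
    below it, hence monotone for arbitrary functions. *)
Lemma ge0_le_integralT d (T : measurableType d) (R : realType)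
    (mu : {measure set T -> \bar R}) (f g : T -> \bar R) :
  (forall x, 0 <= f x)%E -> (forall x, f x <= g x)%E ->
  (\int[mu]_x f x <= \int[mu]_x g x)%E.
Proof.
move=> f0 fg; rewrite !ge0_integralTE//; last first.
  by move=> x; exact: le_trans (f0 x) (fg x).
apply: ge_ereal_sup => _ [h hf <-]; apply: ereal_sup_ubound.
by exists h => // x; exact: le_trans (hf x) (fg x).
Qed.

(** [weighted_bilinear_bound] for the truncated data: the factors (2 pi)^-1 of the
    two waves contribute (2 pi)^-4, of which Schur's constant absorbs (2 pi)^2. *)
Lemma kg_trunc_product_le (R : realType) n (e : R) (F1 F2 : R -> R[i]) : 0 < e ->
  cmeasurable_fun F1 -> cmeasurable_fun F2 ->
  (L2norm lebesgue_measure F1 < +oo)%E -> (L2norm lebesgue_measure F2 < +oo)%E ->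
  (forall x, F1 x = 0 \/ F2 x = 0) ->
  (\int[lebesgue_measure \x lebesgue_measure]_tx (exp_weight e tx.1 * exp_weight e tx.2 *
     (normc2 (kg_trunc n F1 tx) * normc2 (kg_trunc n F2 tx)))%:E <=
   (((2 * pi) ^+ 2)^-1)%:E * \int[lebesgue_measure \x lebesgue_measure]_z
     (normc2 (F1 z.1) * normc2 (F2 z.2) / jacobian z)%:E)%E.
Proof.
move=> e0 mF1 mF2 F1oo F2oo F12.
have ire (F : R -> R[i]) : cmeasurable_fun F -> (L2norm lebesgue_measure F < +oo)%E ->
    lebesgue_measure.-integrable setT (EFin \o trunc n (fun x => complex.Re (F x))).
  move=> mF Foo; apply: (integrable_trunc n (proj1 mF) _ Foo mF) => x.
  by rewrite lerDl sqr_ge0.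
have iim (F : R -> R[i]) : cmeasurable_fun F -> (L2norm lebesgue_measure F < +oo)%E ->
    lebesgue_measure.-integrable setT (EFin \o trunc n (fun x => complex.Im (F x))).
  move=> mF Foo; apply: (integrable_trunc n (proj2 mF) _ Foo mF) => x.
  by rewrite lerDr sqr_ge0.
have bound := weighted_bilinear_bound e0 (ire _ mF1 F1oo) (iim _ mF1 F1oo)
  (ire _ mF2 F2oo) (iim _ mF2 F2oo).
pose c : R := (2 * pi) ^- 2.
have c0 : 0 <= c by rewrite /c invr_ge0 sqr_ge0.
have pi0 : (2 * pi) ^+ 2 != 0 :> R.
  by rewrite sqrf_eq0 mulf_neq0// gt_eqF// pi_gt0.
pose I tx := exp_weight e tx.1 * exp_weight e tx.2 *
  (normc2 (kg_trunc n F1 tx) * normc2 (kg_trunc n F2 tx)).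
have mI : measurable_fun setT I.
  have me : measurable_fun setT (exp_weight e).
    by apply: continuous_measurable_fun; exact: continuous_exp_weight.
  apply: measurable_funM.
    by apply: measurable_funM; exact: (measurableT_comp me).
  by apply: measurable_funM; apply: measurable_normc2; exact: cmeasurable_kg_trunc.
have I0 tx : 0 <= I tx.
  by rewrite mulr_ge0 ?mulr_ge0 ?exp_weight_ge0// normc2_ge0.
have cK : c * (2 * pi) ^+ 2 = 1 by rewrite /c mulVf.
have {}bound := bound _.
have -> : (\int[lebesgue_measure \x lebesgue_measure]_tx (I tx)%:E =
  (c * c)%:E * \int[lebesgue_measure \x lebesgue_measure]_tx
    (((2 * pi) ^+ 2 * (2 * pi) ^+ 2) * I tx)%:E)%E.
  under [in RHS]eq_integral do rewrite EFinM.
  rewrite ge0_integralZl_EFin//; last 3 first.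
  - by move=> tx _; rewrite lee_fin.
  - exact/measurable_EFinP.
  - by rewrite mulr_ge0 ?sqr_ge0.
  by rewrite muleA -EFinM mulrACA !cK mulr1 mul1e.
rewrite -[X in (X%:E * _ <= _)%E]/(c * c).
apply: (@le_trans _ _ ((c * c)%:E * (((2 * pi) ^+ 2)%:E *
    \int[lebesgue_measure \x lebesgue_measure]_z
     (normc2 (F1 z.1) * normc2 (F2 z.2) / jacobian z)%:E))%E); last first.
  by rewrite muleA -EFinM -mulrA cK mulr1.
apply: lee_wpmul2l; first by rewrite lee_fin mulr_ge0.
apply: le_trans (le_trans (bound _) _).
- rewrite le_eqVlt; apply/orP; left; apply/eqP; apply: eq_integral => tx _.
  congr EFin; rewrite /I !normc2_kg_trunc -/c.
  set A := (X in c * X * _); set B := (X in _ * (c * X)).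
  transitivity ((c * (2 * pi) ^+ 2) * (c * (2 * pi) ^+ 2) *
    (exp_weight e tx.1 * exp_weight e tx.2 * (A * B))); first by ring.
  by rewrite cK !mul1r.
- move=> x; rewrite !sqr_trunc; case: (F12 x) => ->; [left|right];
    by rewrite /normc2 /= expr0n /= addr0 mul0r.
apply: lee_wpmul2l; first by rewrite lee_fin sqr_ge0.
apply: ge0_le_integralT => z; first by
  rewrite lee_fin !sqr_trunc divr_ge0 ?jacobian_ge0// mulr_ge0// mulr_ge0 ?normc2_ge0.
rewrite lee_fin !sqr_trunc ler_wpM2r ?invr_ge0 ?jacobian_ge0//.
by rewrite ler_pM ?mulr_ge0 ?normc2_ge0// ler_piMr ?normc2_ge0// indicE; case: (_ \in _).
Qed.

Section limit.
Context (R : realType).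
Notation mu := (@lebesgue_measure R).

Lemma exp_weight_cvg1 (x : R) : exp_weight n.+1%:R^-1 x @[n --> \oo] --> (1 : R).
Proof.
rewrite -[X in _ --> X](@expR0 R) /exp_weight.
apply: continuous_cvg; first exact: continuous_expR.
rewrite -oppr0; apply: cvgN; rewrite -(mul0r `|x|).
by apply: cvgM; [exact: cvg_harmonic|exact: cvg_cst].
Qed.

(** The weights tend to 1, so [normc2M_lsc] bounds the square norm in x of the product,
    at almost every time, by the lower limit of the weighted square norms of the
    truncated products. Fatou's lemma then passes to the integral in time. *)
Lemma kg_product_le (u1 u2 : R * R -> R[i]) (G1 G2 : R -> R[i]) (C : \bar R) :
  cmeasurable_fun u1 -> cmeasurable_fun u2 ->
  cmeasurable_fun G1 -> cmeasurable_fun G2 ->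
  {ae mu, forall t : R, L2norm mu (fun x => u1 (t, x) - kg_trunc n G1 (t, x))
     @[n --> \oo] --> 0%E} ->
  {ae mu, forall t : R, L2norm mu (fun x => u2 (t, x) - kg_trunc n G2 (t, x))
     @[n --> \oo] --> 0%E} ->
  (forall n, \int[mu \x mu]_tx (exp_weight n.+1%:R^-1 tx.1 * exp_weight n.+1%:R^-1 tx.2 *
     (normc2 (kg_trunc n G1 tx) * normc2 (kg_trunc n G2 tx)))%:E <= C)%E ->
  (\int[mu \x mu]_tx (normc2 (u1 tx * u2 tx))%:E <= C)%E.
Proof.
move=> mu1 mu2 mG1 mG2 ae1 ae2 bound.
pose I n (tx : R * R) := exp_weight n.+1%:R^-1 tx.1 * exp_weight n.+1%:R^-1 tx.2 *
     (normc2 (kg_trunc n G1 tx) * normc2 (kg_trunc n G2 tx)).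
have mexpw (e : R) : measurable_fun setT (exp_weight e).
  by apply: continuous_measurable_fun; exact: continuous_exp_weight.
have mI n : measurable_fun setT (EFin \o I n).
  apply/measurable_EFinP; apply: measurable_funM.
    by apply: measurable_funM; exact: (measurableT_comp (mexpw _)).
  by apply: measurable_funM; apply: measurable_normc2; exact: cmeasurable_kg_trunc.
have I0 n tx : (0 <= (EFin \o I n) tx)%E.
  by rewrite lee_fin mulr_ge0 ?mulr_ge0 ?exp_weight_ge0// normc2_ge0.
pose A n (t : R) : \bar R := (\int[mu]_x (I n (t, x))%:E)%E.
have A0 n t : (0 <= A n t)%E by apply: integral_ge0 => x _; exact: I0.
have mA n : measurable_fun setT (A n).
  exact: (@measurable_fun_fubini_tonelli_F _ _ (measurableTypeR R) (measurableTypeR R)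
    R mu (EFin \o I n) (mI n) (I0 n)).
have AC n : (\int[mu]_t A n t <= C)%E.
  apply: le_trans (bound n).
  by rewrite (@fubini_tonelli1 _ _ (measurableTypeR R) (measurableTypeR R) R mu mu
    (EFin \o I n) (mI n) (I0 n)).
pose U (tx : R * R) := normc2 (u1 tx) * normc2 (u2 tx).
have mU : measurable_fun setT (EFin \o U).
  by apply/measurable_EFinP; apply: measurable_funM; exact: measurable_normc2.
have U0 tx : (0 <= (EFin \o U) tx)%E by rewrite lee_fin mulr_ge0 ?normc2_ge0.
under eq_integral do rewrite normc2M.
rewrite (_ : (\int[mu \x mu]_tx _)%E = (\int[mu]_t \int[mu]_x (U (t, x))%:E)%E); last first.
  exact: (@fubini_tonelli1 _ _ (measurableTypeR R) (measurableTypeR R) R mu mu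
    (EFin \o U) mU U0).
apply: (@le_trans _ _ (\int[mu]_t limn_einf (A^~ t))%E); last first.
  apply: le_trans (limn_einf_le AC).
  exact: (@fatou _ (measurableTypeR R) R mu setT measurableT A mA (fun n t _ => A0 n t)).
have slice (u : R * R -> R[i]) t : cmeasurable_fun u ->
    cmeasurable_fun (fun x => u (t, x)).
  by move=> [mr mi]; split; [exact: (measurableT_comp mr (pair1_measurable t))|
    exact: (measurableT_comp mi (pair1_measurable t))].
apply: ae_ge0_le_integral => //.
- by move=> t _; apply: integral_ge0 => x _; exact: U0.
- exact: (@measurable_fun_fubini_tonelli_F _ _ (measurableTypeR R) (measurableTypeR R)
    R mu (EFin \o U) mU U0).
- by move=> t _; apply: limn_einf_ge0 => n; exact: A0.
- exact: measurable_limn_einf.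
apply: aeS (aeI ae1 ae2) => t [h1 h2] _.
apply: (@normc2M_lsc _ _ _ mu (fun x => u1 (t, x)) (fun x => u2 (t, x))
  (fun n x => kg_trunc n G1 (t, x)) (fun n x => kg_trunc n G2 (t, x))
  (fun n x => exp_weight n.+1%:R^-1 t * exp_weight n.+1%:R^-1 x)).
- exact: slice.
- exact: slice.
- by move=> n; apply: slice; exact: cmeasurable_kg_trunc.
- by move=> n; apply: slice; exact: cmeasurable_kg_trunc.
- by move=> n; apply: measurable_funM => //; exact: mexpw.
- by move=> n x; rewrite mulr_ge0 ?exp_weight_ge0.
- by move=> x; rewrite -[X in _ --> X]mulr1; apply: cvgM; exact: exp_weight_cvg1.
- by move=> e e0; exact: L2_cvg0 h1 e0.
- by move=> e e0; exact: L2_cvg0 h2 e0.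
Qed.

End limit.

(** * The bilinear estimate *)

(* The last factor is inverted in \bar R, so that it is +oo when xi_1 = xi_2. *)
Theorem theorem1p4 (R : realType) (f1 f2 F1 F2 : R -> R[i])
    (u1 u2 : R * R -> R[i])
    (hf1 : inL2 lebesgue_measure f1) (hf2 : inL2 lebesgue_measure f2)
    (hF1 : is_fourier f1 F1) (hF2 : is_fourier f2 F2)
    (hu1 : is_klein_gordon f1 u1) (hu2 : is_klein_gordon f2 u2)
    (hsupp : ess_support F1 `&` ess_support F2 = set0) :
  (L2norm (lebesgue_measure \x lebesgue_measure)
     (fun tx : R * R => u1 tx * u2 tx)%R ^+ 2 <=
   (((2 * pi) ^+ 2)^-1)%R%:E *
   \int[lebesgue_measure \x lebesgue_measure]_xi
     ((ComplexField.Normc.normc (F1 xi.1) ^+ 2 *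
       ComplexField.Normc.normc (F2 xi.2) ^+ 2)%R%:E *
      ((1 - (1 + xi.1 * xi.2) /
           (Num.sqrt (1 + xi.1 ^+ 2) * Num.sqrt (1 + xi.2 ^+ 2)))%R%:E)^-1))%E.
Proof.
have [mu1 [H1 hH1 ae1]] := hu1; have [mu2 [H2 hH2 ae2]] := hu2.
have [[mF1 F1oo] _] := hF1; have [[mF2 F2oo] _] := hF2.
have [[mH1 _] _] := hH1; have [[mH2 _] _] := hH2.
have H1F1 := is_fourier_unique (proj1 hf1) hH1 hF1.
have H2F2 := is_fourier_unique (proj1 hf2) hH2 hF2.
(* F1 is replaced by 0 off the zero set of F2, so that the product F1 F2
   vanishes everywhere; this changes F1 on a null set only *)
pose Z : set R := [set x | normc2 (F2 x) = 0].
have mZ : measurable Z.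
  rewrite (_ : Z = setT `&` (fun x => normc2 (F2 x)) @^-1` [set 0]).
    by apply: measurable_normc2 => //; exact: measurable_set1.
  by rewrite setTI.
pose G1 x := (\1_Z x)%:C * F1 x.
have normc2G1 x : normc2 (G1 x) = \1_Z x * normc2 (F1 x).
  rewrite /G1 normc2M /normc2 /= expr0n /= addr0 indicE.
  by case: (_ \in _); rewrite ?expr1n ?mul1r ?expr0n ?mul0r.
have mG1 : cmeasurable_fun G1.
  have m1 : measurable_fun setT (\1_Z : R -> R) by exact: measurable_indic.
  split.
    rewrite (_ : (fun x => _) = (fun x => \1_Z x * complex.Re (F1 x))).
      by apply: measurable_funM => //; exact: (proj1 mF1).
    by apply/funext => x; rewrite ReZ.
  rewrite (_ : (fun x => _) = (fun x => \1_Z x * complex.Im (F1 x))).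
    by apply: measurable_funM => //; exact: (proj2 mF1).
  by apply/funext => x; rewrite ImZ.
have le1 x : normc2 (G1 x) <= normc2 (F1 x).
  by rewrite normc2G1 indicE; case: (_ \in _); rewrite ?mul1r// mul0r normc2_ge0.
have G1oo : (L2norm lebesgue_measure G1 < +oo)%E.
  have : (L2norm lebesgue_measure G1 ^+ 2 < +oo)%E.
    apply: (@le_lt_trans _ _ (L2norm lebesgue_measure F1 ^+ 2)%E).
      rewrite !L2norm_sqr; apply: ge0_le_integralT => x.
        by rewrite lee_fin normc2_ge0.
      by rewrite lee_fin.
    by rewrite expe2 lte_mul_pinfty ?Lnorm_ge0// ge0_fin_numE ?Lnorm_ge0.
  by rewrite !ltey; apply: contra => /eqP ->; rewrite expe2.
have G1F2 x : G1 x = 0 \/ F2 x = 0.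
  have [Zx|Zx] := pselect (Z x); first by right; exact: normc2_eq0.
  by left; rewrite /G1 indicE memNset// mul0r.
have H1G1 : {ae lebesgue_measure, forall x : R, H1 x = G1 x}.
  apply: aeS (aeI H1F1 (ess_support_disjoint hsupp)) => x [-> F12].
  rewrite /G1 indicE; case: F12 => [->|F20]; first by rewrite mulr0.
  rewrite mem_set; first by rewrite mul1r.
  by rewrite /Z /= F20 /normc2 /= expr0n /= addr0.
rewrite L2norm_sqr; apply: (kg_product_le mu1 mu2 mG1 mF2).
- apply: aeS ae1 => t ht.
  under eq_fun => n do rewrite -(ae_kg_trunc n mH1 mG1 H1G1).
  exact: ht.
- apply: aeS ae2 => t ht.
  under eq_fun => n do rewrite -(ae_kg_trunc n mH2 mF2 H2F2).
  exact: ht.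
move=> n; have n0 : 0 < n.+1%:R^-1 :> R by rewrite invr_gt0.
apply: le_trans (kg_trunc_product_le n n0 mG1 mF2 G1oo F2oo G1F2) _.
apply: lee_wpmul2l; first by rewrite lee_fin invr_ge0 sqr_ge0.
apply: ge0_le_integralT => z.
  by rewrite lee_fin divr_ge0 ?jacobian_ge0// mulr_ge0 ?normc2_ge0.
rewrite !sqr_normc.
apply: le_trans (div_jacobian_le z _); last by rewrite mulr_ge0 ?normc2_ge0.
by rewrite lee_fin ler_wpM2r ?invr_ge0 ?jacobian_ge0// ler_wpM2r ?normc2_ge0.
Qed.
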